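(* In ICaTT, the left and right inverses of any invertibility structure are invertible: for every context $\Gamma$ of ICaTT, every term $\Gamma\vdash t:u\to v$ and every $\Gamma\vdash e:\mathrm{Inv}(t)$, the terms $\mathrm{linv}(e)$ and $\mathrm{rinv}(e)$ are invertible in $\Gamma$, i.e. the types $\mathrm{Inv}(\mathrm{linv}(e))$ and $\mathrm{Inv}(\mathrm{rinv}(e))$ are inhabited in $\Gamma$.
   Context: \textbf{CaTT.} Raw syntax: types $A::=*\mid t\to_A u$; terms $t::=x\mid\mathrm{coh}_{\Gamma,A}[\gamma]$ with $x$ a variable; contexts are finite lists $(x_1:A_1,\dots,x_k:A_k)$ and substitutions finite lists $\langle x_1\mapsto t_1,\dots,x_k\mapsto t_k\rangle$; the empty ones are $\varnothing$ and $\langle\rangle$. Contexts are identified up to renaming of variables. Substitutions act on types and terms by replacing variables, with $\mathrm{coh}_{\Gamma,A}[\delta][\gamma]=\mathrm{coh}_{\Gamma,A}[\delta\circ\gamma]$, where $\langle x_i\mapsto t_i\rangle\circ\gamma=\langle x_i\mapsto t_i[\gamma]\rangle$. Dimensions: $\dim *=-1$, $\dim(t\to_Au)=\dim A+1$, $\dim\varnothing=-1$, $\dim(\Gamma,x:A)=\max(\dim\Gamma,\dim A+1)$; a term of type $A$ has dimension $\dim A+1$. The judgements $\Gamma\vdash$ (context), $\Gamma\vdash A$ (type), $\Gamma\vdash t:A$ (term), $\Delta\vdash\gamma:\Gamma$ (substitution) are generated by the usual structural rules ($\varnothing\vdash$; $\Gamma,x:A\vdash$ if $\Gamma\vdash A$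 and $x$ is fresh; $\Gamma\vdash x:A$ if $(x:A)\in\Gamma$; $\Delta\vdash\langle\rangle:\varnothing$; $\Delta\vdash\langle\gamma,x\mapsto t\rangle:(\Gamma,x:A)$ if $\Delta\vdash\gamma:\Gamma$, $\Gamma\vdash A$ and $\Delta\vdash t:A[\gamma]$) and: $\Gamma\vdash *$ if $\Gamma\vdash$; $\Gamma\vdash u\to_Av$ if $\Gamma\vdash u:A$ and $\Gamma\vdash v:A$ with $A$ equal to $*$ or an arrow type; and the coherence rule below. The source and target of a term of type $u\to_A v$ are $u$ and $v$; the index $A$ is often omitted. Pasting diagrams: $\Gamma\vdash_{\mathrm{ps}}x:A$ is generated by $(x:* )\vdash_{\mathrm{ps}}x:*$; if $\Gamma\vdash_{\mathrm{ps}}f:x\to_Ay$ then $\Gamma\vdash_{\mathrm{ps}}y:A$; if $\Gamma\vdash_{\mathrm{ps}}x:A$ then $(\Gamma,y:A,f:x\to_Ay)\vdash_{\mathrm{ps}}f:x\to_Ay$. $\Gamma$ is a pasting diagram if $\Gamma\vdash_{\mathrm{ps}}x:*$ for some $x$. A source (resp. target) variable of a pasting diagram is one that is not the target (resp. source) of another variable. A term uses a variable if it occurs in the term or its type. A valid type $u\to_Av$ in a pasting diagram $\Gamma$ of dimension $n$ is full if either $u$ and $v$ both use all variables of $\Gamma$, or $\dim u=\dim v=n-1$ and $u$ (resp. $v$) uses all source (resp. target) variables of $\Gamma$ of dimension at most $n-1$. Coherence rule: if $\Gamma$ is a pasting diagram, $A$ a full type in $\Gamma$ and $\Delta\vdash\gamma:\Gamma$,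 then $\Delta\vdash\mathrm{coh}_{\Gamma,A}[\gamma]:A[\gamma]$. Suspension $\Sigma$: $\Sigma\varnothing=(v^-:*,v^+:* )$ with fresh $v^\pm$, $\Sigma(\Gamma,x:A)=(\Sigma\Gamma,x:\Sigma A)$, $\Sigma *=(v^-\to_*v^+)$, $\Sigma(u\to_Av)=(\Sigma u\to_{\Sigma A}\Sigma v)$, $\Sigma x=x$, $\Sigma\mathrm{coh}_{\Gamma,A}[\gamma]=\mathrm{coh}_{\Sigma\Gamma,\Sigma A}[\Sigma\gamma]$, $\Sigma\langle\rangle=\langle v^-\mapsto v^-,v^+\mapsto v^+\rangle$, $\Sigma\langle\gamma,x\mapsto t\rangle=\langle\Sigma\gamma,x\mapsto\Sigma t\rangle$. Disks: $\mathbb D^0=(d_0:* )$, $\mathbb D^{n+1}=\Sigma\mathbb D^n$, with top-dimensional variable of $\mathbb D^n$ denoted $d_n$. A term $t$ of dimension $n$ in $\Gamma$ (with type $*$ or an arrow) corresponds to the unique substitution $\Gamma\vdash\chi_t:\mathbb D^n$ with $d_n[\chi_t]=t$ (other variables go to iterated sources and targets of $t$). Identity and composition: $\mathrm{id}\,x=\mathrm{coh}_{(x:* ),x\to x}[\mathrm{id}]$ in $(x:* )$, and $f*g=\mathrm{coh}_{\Gamma,x\to z}[\mathrm{id}]:x\to z$ in $\Gamma=(x:*,y:*,f:x\to y,z:*,g:y\to z)$; by suspending and substituting, $\mathrm{id}\,x$ and $f*g$ are defined for terms $x:A$, $f:x\to_Ay$, $g:y\to_Az$ of any dimension in any context. \textbf{ICaTT}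 keeps all rules of CaTT and adds a type constructor $\mathrm{Inv}_A(t)$ (index often omitted) and term constructors $\mathrm{can}(t,\{e_x\})$, $\mathrm{coind}(t,t_l,t_r,t_{lu},t_{ru},t_{ilu},t_{iru})$, $\mathrm{rec}(t,t_l,t_r,t_{lu},t_{ru},t_{ilu},t_{iru},\gamma)$, $\mathrm{linv}(t)$, $\mathrm{rinv}(t)$, $\mathrm{lunit}(t)$, $\mathrm{runit}(t)$, $\mathrm{ilunit}(t)$, $\mathrm{irunit}(t)$. Suspension commutes with all new constructors. Substitution commutes with all of them except $\mathrm{rec}(\dots,\gamma)[\sigma]=\mathrm{rec}(\dots,\gamma\circ\sigma)$. Judgemental equality $\equiv$ is the congruence generated by the computation rules below; typing is up to $\equiv$. (Inv) If $\Gamma\vdash t:u\to_Av$ then $\Gamma\vdash\mathrm{Inv}(t)$. (Destructors) If $\Gamma\vdash e:\mathrm{Inv}(t)$ with $t:u\to v$, then $\mathrm{linv}(e):v\to u$, $\mathrm{rinv}(e):v\to u$, $\mathrm{lunit}(e):\mathrm{linv}(e)*t\to\mathrm{id}\,v$, $\mathrm{runit}(e):t*\mathrm{rinv}(e)\to\mathrm{id}\,u$, $\mathrm{ilunit}(e):\mathrm{Inv}(\mathrm{lunit}(e))$, $\mathrm{irunit}(e):\mathrm{Inv}(\mathrm{runit}(e))$ in $\Gamma$. (coind) If in $\Gamma$: $t:x\to y$, $t_l,t_r:y\to x$, $t_{lu}:t_l*t\to\mathrm{id}\,y$, $t_{ru}:t*t_r\to\mathrm{id}\,x$, $t_{ilu}:\mathrm{Inv}(t_{lu})$,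 $t_{iru}:\mathrm{Inv}(t_{ru})$, then $\mathrm{coind}(t,t_l,t_r,t_{lu},t_{ru},t_{ilu},t_{iru}):\mathrm{Inv}(t)$. The six $\beta$-rules say that $\mathrm{linv},\mathrm{rinv},\mathrm{lunit},\mathrm{runit},\mathrm{ilunit},\mathrm{irunit}$ of this term are $t_l,t_r,t_{lu},t_{ru},t_{ilu},t_{iru}$ respectively; the $\eta$-rule is $e\equiv\mathrm{coind}(t,\mathrm{linv}(e),\mathrm{rinv}(e),\mathrm{lunit}(e),\mathrm{runit}(e),\mathrm{ilunit}(e),\mathrm{irunit}(e))$ for $e:\mathrm{Inv}(t)$. (can) If $\Delta\vdash t=\mathrm{coh}_{\Gamma,A}[\gamma]:A[\gamma]$ with $\dim A=n$, and $\Delta\vdash e_x:\mathrm{Inv}(x[\gamma])$ for every $(n+1)$-dimensional variable $x$ of $\Gamma$, then $\Delta\vdash\mathrm{can}(t,\{e_x\}):\mathrm{Inv}(t)$. Its $\beta$-rules: $\mathrm{linv},\mathrm{rinv},\mathrm{lunit},\mathrm{runit}$ of $\mathrm{can}(t,\{e_x\})$ are terms $t^{L},t^{R},t^{LU},t^{RU}$ and $\mathrm{ilunit},\mathrm{irunit}$ of it are $\mathrm{can}(t^{LU},\{-\})$, $\mathrm{can}(t^{RU},\{-\})$, as follows. Write $A=u\to v$ and let $\Gamma^{op}$ be the pasting diagram obtained from $\Gamma$ by exchanging source and target of all $(n+1)$-dimensional variables (and reordering). Then $t^L=\mathrm{coh}_{\Gamma^{op},v\to u}[\gamma^L]$, with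 $\gamma^L$ equal to $\gamma$ on variables of dimension $\le n$ and $x\mapsto\mathrm{linv}(e_x)$ on $(n+1)$-dimensional ones; $t^R$ is the same with $\mathrm{rinv}$. $t^{LU}:t^L*t\to\mathrm{id}$ and $t^{RU}:t*t^R\to\mathrm{id}$ are coherence terms: if $\dim\Gamma\le n$, a coherence over $\Gamma$ applied to $\gamma$; if $\dim\Gamma=n+1$, a composite of an associator grouping chains of arguments with their inverses, a cancellation of these using $\mathrm{lunit}(e_x)$ (resp. $\mathrm{runit}(e_x)$), and a unitor; $\{-\}$ is the resulting family of invertibility terms for their top-dimensional arguments, built from $\mathrm{can}$ and $\mathrm{ilunit}(e_x)$ (resp. $\mathrm{irunit}(e_x)$). This is a fixed choice (following the construction of Benjamin and Markakis), stable under substitution and suspension. (rec) Let $\mathbb E^{n+1}=(\mathbb D^{n+1},e_{n+1}:\mathrm{Inv}(d_{n+1}))$; then $\Sigma\mathbb E^{n+1}=\mathbb E^{n+2}$. For $\Gamma\vdash e:\mathrm{Inv}(t)$ with $t$ of dimension $n+1$, $\Gamma\vdash\chi_e:\mathbb E^{n+1}$ is the substitution extending $\chi_t$ by $e_{n+1}\mapsto e$. For $\mathbb E^{n+1}\vdash t:x\to y$ let $\mathbb E^{n+1}_t=(\mathbb E^{n+1},\,h^-:\mathrm{Inv}(\Sigma t)[\chi_{\mathrm{ilunit}(e_{n+1})}],\,h^+:\mathrm{Inv}(\Sigma t)[\chi_{\mathrm{irunit}(e_{n+1})}])$. If in $\mathbb E^{n+1}$: $t:x\to y$, $t_l,t_r:y\to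 x$, $t_{lu}:t_l*t\to\mathrm{id}\,y$, $t_{ru}:t*t_r\to\mathrm{id}\,x$, and in $\mathbb E^{n+1}_t$: $t_{ilu}:\mathrm{Inv}(t_{lu})$, $t_{iru}:\mathrm{Inv}(t_{ru})$, and $\Gamma\vdash\gamma:\mathbb E^{n+1}$, then $\Gamma\vdash\mathrm{rec}(t,t_l,t_r,t_{lu},t_{ru},t_{ilu},t_{iru},\gamma):\mathrm{Inv}(t[\gamma])$. $\beta$-rules: $\mathrm{linv},\mathrm{rinv},\mathrm{lunit},\mathrm{runit}$ of it are $t_l[\gamma],t_r[\gamma],t_{lu}[\gamma],t_{ru}[\gamma]$, and $\mathrm{ilunit},\mathrm{irunit}$ of it are $t_{ilu}[\langle r\rangle\circ\gamma]$, $t_{iru}[\langle r\rangle\circ\gamma]$, where $r=\mathrm{rec}(t,t_l,t_r,t_{lu},t_{ru},t_{ilu},t_{iru},\mathrm{id}_{\mathbb E^{n+1}})$ and $\langle r\rangle=\langle\mathrm{id}_{\mathbb E^{n+1}},h^-\mapsto(\Sigma r)[\chi_{\mathrm{ilunit}(e_{n+1})}],h^+\mapsto(\Sigma r)[\chi_{\mathrm{irunit}(e_{n+1})}]\rangle$. \textbf{Convention.} A term $\Gamma\vdash t:u\to v$ of ICaTT is called invertible in $\Gamma$ if there is a term $\Gamma\vdash e:\mathrm{Inv}(t)$ (an invertibility structure on $t$). *)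

(* Defs.v *)
(* The type theories CaTT and ICaTT, over nat, seq and bool from MathComp.

   Variables are de Bruijn levels: [Var i] is the i-th entry of the ambient
   context, counted from the left (oldest entry first).  A context is the list
   of its types and a substitution the list of its terms, so that contexts are
   literally identified up to renaming, freshness is automatic, and a term of
   a context is unchanged (no lifting) when that context is extended. *)
From mathcomp Require Import all_boot.

Set Implicit Arguments.
Unset Strict Implicit.
Unset Printing Implicit Defensive.

(** * Raw syntax *)

Inductive destr := Linv | Rinv | Lunit | Runit | Ilunit | Irunit.

(* [Inv A t] is indexed by the full type [A] of [t], and [Arr A u v] by the
   common type [A] of [u] and [v].  In [Can t es] the family [es] lists the
   e_x in the order of the top-dimensional variables x. *)
Inductive ty : Type :=
  | Star
  | Arr (A : ty) (u v : tm)
  | Inv (A : ty) (t : tm)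
with tm : Type :=
  | Var (i : nat)
  | Coh (G : seq ty) (A : ty) (g : seq tm)
  | Can (t : tm) (es : seq tm)
  | Coind (t tl tr tlu tru tilu tiru : tm)
  | Rec (t tl tr tlu tru tilu tiru : tm) (g : seq tm)
  | Des (d : destr) (e : tm).

Definition ctx := seq ty.
Definition sub := seq tm.

Notation linv := (Des Linv).
Notation rinv := (Des Rinv).
Notation lunit := (Des Lunit).
Notation runit := (Des Runit).
Notation ilunit := (Des Ilunit).
Notation irunit := (Des Irunit).

(* Value of out-of-range variables.  It is closed, so that the raw law
   t[g][s] = t[g o s] holds without any scoping hypothesis. *)
Definition junk : tm := Coh [::] Star [::].

Fixpoint subst_tm (s : sub) (t : tm) : tm :=
  match t with
  | Var i => nth junk s i
  | Coh G A g => Coh G A (map (subst_tm s) g)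
  | Can t es => Can (subst_tm s t) (map (subst_tm s) es)
  | Coind t tl tr tlu tru tilu tiru =>
      Coind (subst_tm s t) (subst_tm s tl) (subst_tm s tr) (subst_tm s tlu)
            (subst_tm s tru) (subst_tm s tilu) (subst_tm s tiru)
  | Rec t tl tr tlu tru tilu tiru g =>
      Rec t tl tr tlu tru tilu tiru (map (subst_tm s) g)
  | Des d e => Des d (subst_tm s e)
  end.

Fixpoint subst_ty (s : sub) (A : ty) : ty :=
  match A with
  | Star => Star
  | Arr A u v => Arr (subst_ty s A) (subst_tm s u) (subst_tm s v)
  | Inv A t => Inv (subst_ty s A) (subst_tm s t)
  end.

(* comp_sub g s is g o s, "first g, then s" in the order of t[g][s]. *)
Definition comp_sub (g s : sub) : sub := map (subst_tm s) g.

Definition vars (n : nat) : sub := map Var (iota 0 n).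
Definition id_sub (G : ctx) : sub := vars (size G).

(* Suspension: the two new variables v^-, v^+ are the levels 0 and 1. *)
Fixpoint susp_ty (A : ty) : ty :=
  match A with
  | Star => Arr Star (Var 0) (Var 1)
  | Arr A u v => Arr (susp_ty A) (susp_tm u) (susp_tm v)
  | Inv A t => Inv (susp_ty A) (susp_tm t)
  end
with susp_tm (t : tm) : tm :=
  match t with
  | Var i => Var i.+2
  | Coh G A g =>
      Coh [:: Star, Star & map susp_ty G] (susp_ty A)
          [:: Var 0, Var 1 & map susp_tm g]
  | Can t es => Can (susp_tm t) (map susp_tm es)
  | Coind t tl tr tlu tru tilu tiru =>
      Coind (susp_tm t) (susp_tm tl) (susp_tm tr) (susp_tm tlu)
            (susp_tm tru) (susp_tm tilu) (susp_tm tiru)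
  | Rec t tl tr tlu tru tilu tiru g =>
      Rec (susp_tm t) (susp_tm tl) (susp_tm tr) (susp_tm tlu)
          (susp_tm tru) (susp_tm tilu) (susp_tm tiru)
          [:: Var 0, Var 1 & map susp_tm g]
  | Des d e => Des d (susp_tm e)
  end.

Definition susp_ctx (G : ctx) : ctx := [:: Star, Star & map susp_ty G].

(* Variables occurring in a type or a term.  The first arguments of [Coh] and
   [Rec] live in their own context, so only the substitution counts. *)
Fixpoint fv_tm (t : tm) : seq nat :=
  match t with
  | Var i => [:: i]
  | Coh _ _ g => flatten (map fv_tm g)
  | Can t es => fv_tm t ++ flatten (map fv_tm es)
  | Coind t tl tr tlu tru tilu tiru =>
      fv_tm t ++ fv_tm tl ++ fv_tm tr ++ fv_tm tlu ++ fv_tm tru ++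
      fv_tm tilu ++ fv_tm tiru
  | Rec _ _ _ _ _ _ _ g => flatten (map fv_tm g)
  | Des _ e => fv_tm e
  end.

Fixpoint fv_ty (A : ty) : seq nat :=
  match A with
  | Star => [::]
  | Arr A u v => fv_ty A ++ fv_tm u ++ fv_tm v
  | Inv A t => fv_ty A ++ fv_tm t
  end.

(* tdim A = dim A + 1, the dimension of the terms of type A (dim * = -1).
   No dimension is attached to an Inv type; the value 0 is a dummy. *)
Fixpoint tdim (A : ty) : nat :=
  match A with
  | Arr A _ _ => (tdim A).+1
  | _ => 0
  end.

Definition vdim (G : ctx) (i : nat) : nat := tdim (nth Star G i).

(* Used on pasting diagrams only; these are nonempty, so that the convention
   for the empty context is irrelevant. *)
Definition cdim (G : ctx) : nat := foldr maxn 0 [seq tdim A | A <- G].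

(** * Pasting diagrams and full types *)

Inductive ps : ctx -> tm -> ty -> Prop :=
  | ps_point : ps [:: Star] (Var 0) Star
  | ps_drop G f A x y : ps G f (Arr A x y) -> ps G y A
  | ps_ext G x A : ps G x A ->
      ps (G ++ [:: A; Arr A x (Var (size G))])
         (Var (size G).+1) (Arr A x (Var (size G))).

Definition pasting (G : ctx) : Prop := exists i, ps G (Var i) Star.

Definition is_var (i : nat) (t : tm) : bool :=
  if t is Var j then i == j else false.

Definition source_var (G : ctx) (i : nat) : bool :=
  ~~ has (fun B => if B is Arr _ _ v then is_var i v else false) G.
Definition target_var (G : ctx) (i : nat) : bool :=
  ~~ has (fun B => if B is Arr _ u _ then is_var i u else false) G.

Definition uses (A : ty) (t : tm) (i : nat) : bool :=
  (i \in fv_tm t) || (i \in fv_ty A).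

(* Fullness, without the validity of the type.  The dimension of u and v is
   tdim A. *)
Definition full (G : ctx) (T : ty) : bool :=
  if T is Arr A u v then
    let I := iota 0 (size G) in
    all (fun i => uses A u i && uses A v i) I
    || [&& (tdim A).+1 == cdim G,
           all (fun i => (vdim G i <= tdim A) && source_var G i ==> uses A u i) I
         & all (fun i => (vdim G i <= tdim A) && target_var G i ==> uses A v i) I]
  else false.

(** * Disks, identities and composites *)

(* The type of d_n in D^n, where d_n is the variable 2n. *)
Definition disk_ty (n : nat) : ty := iter n susp_ty Star.
Definition disk (n : nat) : ctx := iter n susp_ctx [:: Star].

(* The iterated sources and targets of a term of type A: if t : A has
   dimension n then chi A t : D^n, and chi_inv A t e : E^n for e : Inv A t. *)
Fixpoint bdry (A : ty) : sub :=
  if A is Arr A u v then bdry A ++ [:: u; v] else [::].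
Definition chi (A : ty) (t : tm) : sub := rcons (bdry A) t.
Definition chi_inv (A : ty) (t e : tm) : sub := bdry A ++ [:: t; e].

(* The coherence with pasting diagram G and type T, suspended so that the
   variables of type * in G become variables of type A, applied to args. *)
Definition coh_at (A : ty) (G : ctx) (T : ty) (args : sub) : tm :=
  Coh (iter (tdim A) susp_ctx G) (iter (tdim A) susp_ty T) (bdry A ++ args).

Definition idt (A : ty) (x : tm) : tm :=
  coh_at A [:: Star] (Arr Star (Var 0) (Var 0)) [:: x].

Definition comp_ctx : ctx :=
  [:: Star; Star; Arr Star (Var 0) (Var 1); Star; Arr Star (Var 1) (Var 3)].

(* f * g, for f : x -> y and g : y -> z with index A. *)
Definition compt (A : ty) (x y z f g : tm) : tm :=
  coh_at A comp_ctx (Arr Star (Var 0) (Var 3)) [:: x; y; f; z; g].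

(* For t : u ->_A v and l, r : v ->_A u, the types l * t -> id v and
   t * r -> id u. *)
Definition lunit_ty (A : ty) (u v t l : tm) : ty :=
  Arr (Arr A v v) (compt A v u v l t) (idt A v).
Definition runit_ty (A : ty) (u v t r : tm) : ty :=
  Arr (Arr A u u) (compt A u v u t r) (idt A u).

Definition destr_ty (d : destr) (A : ty) (u v t e : tm) : ty :=
  match d with
  | Linv | Rinv => Arr A v u
  | Lunit => lunit_ty A u v t (linv e)
  | Runit => runit_ty A u v t (rinv e)
  | Ilunit => Inv (lunit_ty A u v t (linv e)) (lunit e)
  | Irunit => Inv (runit_ty A u v t (rinv e)) (runit e)
  end.

(** * The contexts of the recursor *)

(* einv n is E^{n+1}; in it, d_{n+1} is the variable 2n+2 and e_{n+1} the
   variable 2n+3. *)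
Definition einv (n : nat) : ctx :=
  rcons (disk n.+1) (Inv (disk_ty n.+1) (Var n.+1.*2)).

(* chi_{ilunit(e_{n+1})} and chi_{irunit(e_{n+1})}, from E^{n+1} to E^{n+2}. *)
Definition chi_unit (l i : destr) (n : nat) : sub :=
  let d := Var n.+1.*2 in
  let e := Var n.+1.*2.+1 in
  if disk_ty n.+1 is Arr A u v
  then chi_inv (destr_ty l A u v d e) (Des l e) (Des i e) else [::].
Definition chi_ilunit : nat -> sub := chi_unit Lunit Ilunit.
Definition chi_irunit : nat -> sub := chi_unit Runit Irunit.

(* E^{n+1}_t, for t of type T. *)
Definition einv_ext (n : nat) (T : ty) (t : tm) : ctx :=
  einv n ++ [:: subst_ty (chi_ilunit n) (Inv (susp_ty T) (susp_tm t));
                subst_ty (chi_irunit n) (Inv (susp_ty T) (susp_tm t))].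

(* The substitution <r> from E^{n+1} to E^{n+1}_t. *)
Definition rec_ext (n : nat) (r : tm) : sub :=
  id_sub (einv n) ++ [:: subst_tm (chi_ilunit n) (susp_tm r);
                         subst_tm (chi_irunit n) (susp_tm r)].

(** * The inverses and cancellators of a coherence term

   Let G be a pasting diagram of dimension at most d, where d = dim A + 1 is
   the dimension of coh_{G,A}.  Erasing the d-dimensional variables of G and
   their targets leaves a pasting diagram B of dimension < d, and G is
   recovered from B by inserting, after the variable i of B, a chain of k_i
   composable d-dimensional variables starting at i:
     x_{i,0} = i, x_{i,1}, f_{i,1}, ..., x_{i,k}, f_{i,k}
   with f_{i,j} : x_{i,j-1} -> x_{i,j} (k_i = 0 unless i has dimension d-1).
   So G is encoded by B and the list ms of the k_i; altering ms gives all the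
   other pasting diagrams needed below. *)

(* chain k W H = W 0, W 1, H 1, ..., W k, H k *)
Definition chain {T : Type} (k : nat) (W H : nat -> T) : seq T :=
  W 0 :: flatten [seq [:: W j; H j] | j <- iota 1 k].

Definition chains {T : Type} (ms : seq nat) (W H : nat -> nat -> T) : seq T :=
  flatten [seq chain (nth 0 ms i) (W i) (H i) | i <- iota 0 (size ms)].

(* Positions of x_{i,j} and of f_{i,j} (j >= 1) in the expanded diagram. *)
Definition vtx (ms : seq nat) (i j : nat) : nat :=
  i + (sumn (take i ms)).*2 + (j.*2).-1.
Definition edg (ms : seq nat) (i j : nat) : nat :=
  i + (sumn (take i ms)).*2 + j.*2.

Definition expand_ty (B : ctx) (ms : seq nat) (i : nat) : ty :=
  subst_ty [seq Var (vtx ms l 0) | l <- iota 0 (size ms)] (nth Star B i).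
Definition expand (B : ctx) (ms : seq nat) : ctx :=
  chains ms (fun i _ => expand_ty B ms i)
    (fun i j => Arr (expand_ty B ms i) (Var (vtx ms i j.-1)) (Var (vtx ms i j))).

(* Conversely: the variables of G kept in B, then B and ms. *)
Definition roots (d : nat) (G : ctx) : seq nat :=
  [seq i <- iota 0 (size G) | (vdim G i < d) && (vdim G i.+1 != d)].
Definition base (d : nat) (G : ctx) : ctx :=
  let r := roots d G in
  [seq subst_ty [seq Var (index l r) | l <- iota 0 (size G)] (nth Star G i)
  | i <- r].
Definition mults (d : nat) (G : ctx) : seq nat :=
  let r := roots d G in
  [seq (p.2 - p.1).-1./2 | p <- zip r (rcons (behead r) (size G))].

(* The unbiased composite of x_0 -h_1-> x_1 ... -h_k-> x_k (k >= 1), where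
   ws = x_0, x_1, h_1, ..., x_k, h_k and the x_j have type A. *)
Definition lcomp (A : ty) (ws : sub) : tm :=
  let k := (size ws)./2 in
  coh_at A (expand [:: Star] [:: k]) (Arr Star (Var 0) (Var (k.*2).-1)) ws.

(* Cancellation of a composite of adjacent inverses
     w_s -l_{s+1}-> w_{s+1} ... -l_{s+m}-> w_{s+m}
         -r_{s+m}-> w_{s+m-1} ... -r_{s+1}-> w_s,
   from given cells un_j : l_j * r_j -> id w_{j-1}. *)
Section Telescope.
Context (A : ty) (w l r un iun : nat -> tm).

Definition zig (m s : nat) : sub :=
  chain m.*2 (fun j => w (s + minn j (m.*2 - j)))
    (fun j => if j <= m then l (s + j) else r (s + (m.*2.+1 - j))).

Definition whisker_ctx : ctx :=
  let a := Arr Star in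
  [:: Star; Star; a (Var 0) (Var 1);
      Star; a (Var 1) (Var 3); a (Var 1) (Var 3);
      Arr (a (Var 1) (Var 3)) (Var 4) (Var 5);
      Star; a (Var 3) (Var 7)].

(* A telescope of m+1 layers, with its invertibility structure. For several
   layers, it regroups the composite around the inner layers, cancels those
   recursively, removes the resulting identity, and applies un to the outermost
   layer. *)
Fixpoint telescope (m s : nat) : tm * tm :=
  if m is m'.+1 then
    let M := m'.+2 in
    let inner := telescope m' s.+1 in
    let x := w s in
    let y := w s.+1 in
    let f := l s.+1 in
    let g := r s.+1 in
    let V := fun j => Var (j.*2).-1 in
    let H := fun j => Var j.*2 in
    let c := lcomp A (zig M s) in
    let c1 := lcomp A (zig m'.+1 s.+1) in
    let a1 := coh_at A (expand [:: Star] [:: M.*2])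
       (Arr (Arr Star (V 0) (V M.*2))
            (lcomp Star (vars (M.*2.*2).+1))
            (lcomp Star [:: V 0; V 1; H 1; V M.*2.-1;
               lcomp Star (chain m'.+1.*2 (fun j => V j.+1) (fun j => H j.+1));
               V M.*2; H M.*2]))
       (zig M s) in
    let a2 := coh_at A whisker_ctx
       (Arr (Arr Star (Var 0) (Var 7))
            (lcomp Star [:: Var 0; Var 1; Var 2; Var 3; Var 4; Var 7; Var 8])
            (lcomp Star [:: Var 0; Var 1; Var 2; Var 3; Var 5; Var 7; Var 8]))
       [:: x; y; f; y; c1; idt A y; inner.1; x; g] in
    let a3 := coh_at A comp_ctx
       (Arr (Arr Star (Var 0) (Var 3))
            (lcomp Star [:: Var 0; Var 1; Var 2; Var 1; idt Star (Var 1); Var 3; Var 4])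
            (lcomp Star (vars 5)))
       [:: x; y; f; x; g] in
    let t := lcomp (Arr A x x)
       [:: c; lcomp A [:: x; y; f; y; c1; x; g]; a1;
              lcomp A [:: x; y; f; y; idt A y; x; g]; a2;
              compt A x y x f g; a3;
              idt A x; un s.+1] in
    (t, Can t [:: Can a1 [::]; Can a2 [:: inner.2]; Can a3 [::]; iun s.+1])
  else (un s.+1, iun s.+1).

End Telescope.

(* In this section t = coh_{G,u -> v}, the arrow u -> v has index C and u, v
   have dimension n = tdim C.  All terms live in the generic context made of G
   followed by one variable e_x : Inv(x) for each (n+1)-dimensional variable x
   of G, in order; substituting gamma, {e_x} for these variables gives the
   terms for coh_{G,u -> v}[gamma].  The boolean b selects the side: true for
   t^L, t^LU and false for t^R, t^RU. *)
Section Cancel.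
Context (b : bool) (G : ctx) (C : ty) (u v : tm).

Let d := (tdim C).+1.
Let B := base d G.
Let ms := mults d G.
Let k i := nth 0 ms i.
Let x i j := Var (vtx ms i j).
Let f i j := Var (edg ms i j).
Let e i j := Var (size G + sumn (take i ms) + j.-1).

(* Exchanging source and target of the (n+1)-dimensional variables reverses
   each chain, so up to renaming G^op is G itself, the variables being permuted
   by the involution op. *)
Definition op : sub :=
  chains ms (fun i j => x i (k i - j)) (fun i j => f i ((k i).+1 - j)).
Definition op_ty : ty := subst_ty op (Arr C v u).

Definition can_inv : tm :=
  Coh G op_ty
    (chains ms (fun i j => x i (k i - j))
       (fun i j => Des (if b then Linv else Rinv) (e i ((k i).+1 - j)))).

(* t^L * t = T1 * T2 (resp. t * t^R = T1 * T2), where Tp is the coherence over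
   G with type Ap, and T1 * T2 -> id o. *)
Let o := if b then v else u.
Let A1 := if b then op_ty else Arr C u v.
Let A2 := if b then Arr C u v else op_ty.

(* The chain i of T1 * T2 is the zigzag
   w_0 -lf_1-> w_1 ... -lf_k-> w_k -rg_k-> w_{k-1} ... -rg_1-> w_0. *)
Let old i j := if b then (k i).+1 - j else j.
Let w i j := x i (if b then k i - j else j).
Let lf i j := if b then linv (e i (old i j)) else f i j.
Let rg i j := if b then f i (old i j) else rinv (e i j).
Let un i j := Des (if b then Lunit else Runit) (e i (old i j)).
Let iun i j := Des (if b then Ilunit else Irunit) (e i (old i j)).
Let zigi i := zig (w i) (lf i) (rg i) (k i) 0.
Let tel i := telescope (expand_ty B ms i) (w i) (lf i) (rg i) (un i) (iun i)
               (k i).-1 0.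

(* G2: the diagram of T1 * T2 (all chains twice as long), half h being the
   inclusion of the copy of G for T_{h+1}. *)
Let ms2 := [seq m.*2 | m <- ms].
Let G2 := expand B ms2.
Let half (h : nat) : sub :=
  chains ms (fun i j => Var (vtx ms2 i (h * k i + j)))
            (fun i j => Var (edg ms2 i (h * k i + j))).
Let delta : sub := flatten [seq zigi i | i <- iota 0 (size ms)].

(* G1: each nonempty chain replaced by a single variable.  col h maps each
   chain of G to the source (h = 0) or target (h = 1) of that variable; it is
   only applied to o and its type, in which no (n+1)-dimensional variable
   occurs. *)
Let ms1 := [seq minn 1 m | m <- ms].
Let G1 := expand B ms1.
Let col (h : nat) : sub :=
  chains ms (fun i _ => Var (vtx ms1 i (h * minn 1 (k i)))) (fun _ _ => junk).
Let A' := Arr (subst_ty (col 0) C) (subst_tm (col 0) o) (subst_tm (col 1) o).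

(* Associator: T1 * T2 -> the composite over G1 of the composites of the
   zigzags. *)
Let grouped : tm :=
  Coh G1 A' (chains ms1 (fun i j => Var (vtx ms2 i (j * (k i).*2)))
    (fun i _ => lcomp (expand_ty B ms2 i)
       (chain (k i).*2 (fun j => Var (vtx ms2 i j)) (fun j => Var (edg ms2 i j))))).
Let T1 := Coh G A1 (half 0).
Let T2 := Coh G A2 (half 1).
Let assoc_ty : ty :=
  match subst_ty (half 0) A1, subst_ty (half 1) A2 with
  | Arr D a m, Arr _ _ c => Arr (Arr D a c) (compt D a m c T1 T2) grouped
  | _, _ => Star
  end.
Let assoc := Coh G2 assoc_ty delta.

(* Cancellation: G1p has an (n+2)-dimensional variable p -> p' for each
   (n+1)-dimensional variable p of G1; it is applied to the telescopes. *)
Let msp := [seq (tdim T == d : nat) | T <- G1].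
Let G1p := expand G1 msp.
Let inc (h : nat) : sub :=
  [seq Var (vtx msp p (h * nth 0 msp p)) | p <- iota 0 (size G1)].
Let canc_ty : ty :=
  Arr (subst_ty (inc 0) A') (Coh G1 A' (inc 0)) (Coh G1 A' (inc 1)).
Let canc : tm :=
  Coh G1p canc_ty
    (flatten (chains ms1 (fun i _ => [:: w i 0])
       (fun i _ => let D := expand_ty B ms i in
                   [:: lcomp D (zigi i); idt D (w i 0); (tel i).1]))).

(* Unitor, over B: the composite over G1 of identities -> id o. *)
Let colB : sub := chains ms (fun i _ => Var i) (fun _ _ => junk).
Let unitor_ty : ty :=
  let D := subst_ty colB C in
  let a := subst_tm colB o in
  Arr (Arr D a a)
    (Coh G1 A' (chains ms1 (fun i _ => Var i)
                           (fun i _ => idt (nth Star B i) (Var i))))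
    (idt D a).
Let unitor : tm := Coh B unitor_ty [seq w i 0 | i <- iota 0 (size ms)].

Definition src (t : tm) : tm :=
  if t is Coh _ (Arr _ a _) g then subst_tm g a else junk.
Definition tgt (t : tm) : tm :=
  if t is Coh _ (Arr _ _ a) g then subst_tm g a else junk.

(* t^LU (resp. t^RU) and the invertibility structures of its top-dimensional
   arguments: a coherence over G if dim G <= n, and otherwise the composite of
   associator, cancellation and unitor, as in Benjamin and Markakis,
   "Invertible cells in omega-categories". *)
Definition can_unit : tm * seq tm :=
  if cdim G < d then
    match A1, A2 with
    | Arr D a m, Arr _ _ c =>
        (Coh G (lunit_ty D m a (Coh G A2 (id_sub G)) (Coh G A1 (id_sub G)))
           (id_sub G), [::])
    | _, _ => (junk, [::])
    end
  else
    (lcomp (Arr C o o)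
       [:: src assoc; tgt assoc; assoc; tgt canc; canc; tgt unitor; unitor],
     [:: Can assoc [::];
         Can canc [seq (tel i).2 | i <- iota 0 (size ms) & 0 < k i];
         Can unitor [::]]).

End Cancel.

(** * Right-hand sides of the beta rules *)

Definition can_beta (d : destr) (G : ctx) (C : ty) (u v : tm) (g es : sub) : tm :=
  let lu := can_unit true G C u v in
  let ru := can_unit false G C u v in
  subst_tm (g ++ es)
    match d with
    | Linv => can_inv true G C u v
    | Rinv => can_inv false G C u v
    | Lunit => lu.1
    | Runit => ru.1
    | Ilunit => Can lu.1 lu.2
    | Irunit => Can ru.1 ru.2
    end.

Definition coind_beta (d : destr) (tl tr tlu tru tilu tiru : tm) : tm :=
  match d with
  | Linv => tl | Rinv => tr | Lunit => tlu | Runit => tru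
  | Ilunit => tilu | Irunit => tiru
  end.

Definition rec_beta (d : destr) (n : nat)
    (t tl tr tlu tru tilu tiru : tm) (g : sub) : tm :=
  let r := Rec t tl tr tlu tru tilu tiru (id_sub (einv n)) in
  match d with
  | Linv => subst_tm g tl
  | Rinv => subst_tm g tr
  | Lunit => subst_tm g tlu
  | Runit => subst_tm g tru
  | Ilunit => subst_tm (comp_sub (rec_ext n r) g) tilu
  | Irunit => subst_tm (comp_sub (rec_ext n r) g) tiru
  end.

(** * Judgements *)

Definition is_inv (A : ty) : bool := if A is Inv _ _ then true else false.

(* The variables of dimension d. *)
Definition tops (d : nat) (G : ctx) : seq nat :=
  [seq i <- iota 0 (size G) | vdim G i == d].

Inductive wf_ctx : ctx -> Prop :=
  | wf_ctx_nil : wf_ctx [::]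
  | wf_ctx_ext G A : wf_ty G A -> wf_ctx (rcons G A)

with wf_ty : ctx -> ty -> Prop :=
  | wf_ty_star G : wf_ctx G -> wf_ty G Star
  | wf_ty_arr G A u v :
      ~~ is_inv A -> wf_tm G u A -> wf_tm G v A -> wf_ty G (Arr A u v)
  | wf_ty_inv G A u v t : wf_tm G t (Arr A u v) -> wf_ty G (Inv (Arr A u v) t)

with wf_tm : ctx -> tm -> ty -> Prop :=
  | wf_tm_var G i : wf_ctx G -> i < size G -> wf_tm G (Var i) (nth Star G i)
  | wf_tm_coh D G A g :
      pasting G -> wf_ty G A -> full G A -> wf_sub D g G ->
      wf_tm D (Coh G A g) (subst_ty g A)
  | wf_tm_des G d A u v t e :
      wf_tm G e (Inv (Arr A u v) t) ->
      wf_tm G (Des d e) (destr_ty d A u v t e)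
  | wf_tm_coind G A x y t tl tr tlu tru tilu tiru :
      wf_tm G t (Arr A x y) ->
      wf_tm G tl (Arr A y x) ->
      wf_tm G tr (Arr A y x) ->
      wf_tm G tlu (lunit_ty A x y t tl) ->
      wf_tm G tru (runit_ty A x y t tr) ->
      wf_tm G tilu (Inv (lunit_ty A x y t tl) tlu) ->
      wf_tm G tiru (Inv (runit_ty A x y t tr) tru) ->
      wf_tm G (Coind t tl tr tlu tru tilu tiru) (Inv (Arr A x y) t)
  | wf_tm_can D G A g es :
      wf_tm D (Coh G A g) (subst_ty g A) ->
      size es = size (tops (tdim A) G) ->
      (forall j, j < size es ->
         let i := nth 0 (tops (tdim A) G) j in
         wf_tm D (nth junk es j) (subst_ty g (Inv (nth Star G i) (Var i)))) ->
      wf_tm D (Can (Coh G A g) es) (Inv (subst_ty g A) (Coh G A g))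
  | wf_tm_rec G n A x y t tl tr tlu tru tilu tiru g :
      wf_tm (einv n) t (Arr A x y) ->
      wf_tm (einv n) tl (Arr A y x) ->
      wf_tm (einv n) tr (Arr A y x) ->
      wf_tm (einv n) tlu (lunit_ty A x y t tl) ->
      wf_tm (einv n) tru (runit_ty A x y t tr) ->
      wf_tm (einv_ext n (Arr A x y) t) tilu (Inv (lunit_ty A x y t tl) tlu) ->
      wf_tm (einv_ext n (Arr A x y) t) tiru (Inv (runit_ty A x y t tr) tru) ->
      wf_sub G g (einv n) ->
      wf_tm G (Rec t tl tr tlu tru tilu tiru g) (subst_ty g (Inv (Arr A x y) t))
  | wf_tm_conv G t A A' : wf_tm G t A -> eq_ty G A A' -> wf_ty G A' -> wf_tm G t A'

(* wf_sub D g G is D |- g : G *)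
with wf_sub : ctx -> sub -> ctx -> Prop :=
  | wf_sub_nil D : wf_ctx D -> wf_sub D [::] [::]
  | wf_sub_ext D g G A t :
      wf_sub D g G -> wf_ty G A -> wf_tm D t (subst_ty g A) ->
      wf_sub D (rcons g t) (rcons G A)

(* Judgemental equality: the congruence generated by the computation rules.
   It is relative to a context because the eta and beta rules apply to
   well-typed terms of that context; no other typing is required. *)
with eq_ctx : ctx -> ctx -> Prop :=
  | eq_ctx_nil : eq_ctx [::] [::]
  | eq_ctx_ext G G' A A' :
      eq_ctx G G' -> eq_ty G A A' -> eq_ctx (rcons G A) (rcons G' A')

with eq_ty : ctx -> ty -> ty -> Prop :=
  | eq_ty_refl G A : eq_ty G A A
  | eq_ty_sym G A A' : eq_ty G A A' -> eq_ty G A' A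
  | eq_ty_trans G A A' A'' : eq_ty G A A' -> eq_ty G A' A'' -> eq_ty G A A''
  | eq_ty_arr G A A' u u' v v' :
      eq_ty G A A' -> eq_tm G u u' -> eq_tm G v v' ->
      eq_ty G (Arr A u v) (Arr A' u' v')
  | eq_ty_inv G A A' t t' :
      eq_ty G A A' -> eq_tm G t t' -> eq_ty G (Inv A t) (Inv A' t')

with eq_tm : ctx -> tm -> tm -> Prop :=
  | eq_tm_refl G t : eq_tm G t t
  | eq_tm_sym G t t' : eq_tm G t t' -> eq_tm G t' t
  | eq_tm_trans G t t' t'' : eq_tm G t t' -> eq_tm G t' t'' -> eq_tm G t t''
  | eq_tm_coh D G G' A A' g g' :
      eq_ctx G G' -> eq_ty G A A' -> eq_sub D g g' ->
      eq_tm D (Coh G A g) (Coh G' A' g')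
  | eq_tm_des G d e e' : eq_tm G e e' -> eq_tm G (Des d e) (Des d e')
  | eq_tm_coind G t tl tr tlu tru tilu tiru t' tl' tr' tlu' tru' tilu' tiru' :
      eq_tm G t t' -> eq_tm G tl tl' -> eq_tm G tr tr' ->
      eq_tm G tlu tlu' -> eq_tm G tru tru' ->
      eq_tm G tilu tilu' -> eq_tm G tiru tiru' ->
      eq_tm G (Coind t tl tr tlu tru tilu tiru)
              (Coind t' tl' tr' tlu' tru' tilu' tiru')
  | eq_tm_can G t t' es es' :
      eq_tm G t t' -> eq_sub G es es' -> eq_tm G (Can t es) (Can t' es')
  (* the two typing premises determine the contexts of the components *)
  | eq_tm_rec G n T t tl tr tlu tru tilu tiru g
                    t' tl' tr' tlu' tru' tilu' tiru' g' :
      wf_sub G g (einv n) -> wf_tm (einv n) t T ->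
      eq_tm (einv n) t t' -> eq_tm (einv n) tl tl' -> eq_tm (einv n) tr tr' ->
      eq_tm (einv n) tlu tlu' -> eq_tm (einv n) tru tru' ->
      eq_tm (einv_ext n T t) tilu tilu' -> eq_tm (einv_ext n T t) tiru tiru' ->
      eq_sub G g g' ->
      eq_tm G (Rec t tl tr tlu tru tilu tiru g)
              (Rec t' tl' tr' tlu' tru' tilu' tiru' g')
  | eq_tm_eta G T t e :
      wf_tm G e (Inv T t) ->
      eq_tm G e (Coind t (linv e) (rinv e) (lunit e) (runit e)
                         (ilunit e) (irunit e))
  | eq_tm_coind_beta G T s d t tl tr tlu tru tilu tiru :
      wf_tm G (Coind t tl tr tlu tru tilu tiru) (Inv T s) ->
      eq_tm G (Des d (Coind t tl tr tlu tru tilu tiru))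
              (coind_beta d tl tr tlu tru tilu tiru)
  | eq_tm_can_beta D T s d G C u v g es :
      wf_tm D (Can (Coh G (Arr C u v) g) es) (Inv T s) ->
      eq_tm D (Des d (Can (Coh G (Arr C u v) g) es)) (can_beta d G C u v g es)
  | eq_tm_rec_beta G n T s d t tl tr tlu tru tilu tiru g :
      wf_tm G (Rec t tl tr tlu tru tilu tiru g) (Inv T s) ->
      wf_sub G g (einv n) ->
      eq_tm G (Des d (Rec t tl tr tlu tru tilu tiru g))
              (rec_beta d n t tl tr tlu tru tilu tiru g)

with eq_sub : ctx -> sub -> sub -> Prop :=
  | eq_sub_nil G : eq_sub G [::] [::]
  | eq_sub_cons G t t' g g' :
      eq_tm G t t' -> eq_sub G g g' -> eq_sub G (t :: g) (t' :: g').

(* The term t of type u ->_A v is invertible in G. *)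
Definition invertible (G : ctx) (A : ty) (u v t : tm) : Prop :=
  exists e : tm, wf_tm G e (Inv (Arr A u v) t).

(* Main.v *)
From mathcomp Require Import all_boot.
Require Import Defs.

Set Implicit Arguments.
Unset Strict Implicit.
Unset Printing Implicit Defensive.

(** Write d for the cell t and l, r for the two inverses given by e.  Every
   invertibility structure is the image of the generic one of E^{n+1} under
   the substitution given by it, t and the boundary of t, so the recursor
   reduces the theorem to making l and r invertible in E^{n+1}, where the
   structures on the new units may moreover use the hypotheses h^-, h^+ of
   E^{n+1}_t.

   The inverse of l is d on both sides.  One unit is lunit e : l * d -> id.  The
   other one, d * l -> id, is the usual argument that a left inverse and a right
   inverse agree:
     d * l -> (d * l) * id -> (d * l) * (d * r) -> d * ((l * d) * r)
           -> d * (id * r) -> d * r -> id.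
   The cells used are coherences, lunit e, runit e, and, in the second step, the
   left inverse of runit e.  A composite of invertible cells is invertible by
   can: coherences are invertible by can again, lunit e and runit e by ilunit e
   and irunit e, and the remaining cell linv (irunit e) is exactly the one that
   h^+ declares invertible: the statement being proved, one dimension up.  The
   case of r is the mirror image,
     r * d -> id * (r * d) -> (l * d) * (r * d) -> l * ((d * r) * d)
           -> l * (id * d) -> l * d -> id,
   whose second step uses rinv (ilunit e), hence h^-.

   Two general facts support this.  First, these cells have to be typed in all
   dimensions at once.  A coherence is written over a pasting diagram based at
   dimension 0, where its typing is a finite computation (catt_coh); inst_wf
   then shows that suspending it as often as needed and substituting well-typed
   arguments gives a well-typed cell over any base type.  Second, to substitute
   the boundary of t one must know that this boundary is well typed.  This is
   wf_tm_valid, for which typing has to be stable under substitution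
   (judgement_subst). *)

(** * Raw syntax *)

Fixpoint All (T : Type) (P : T -> Prop) (s : seq T) : Prop :=
  if s is x :: s' then P x /\ All P s' else True.

(** The generated induction principles do not see through the lists of types
   and terms inside coherences. *)
Section SyntaxInduction.
Variables (P : ty -> Prop) (Q : tm -> Prop).
Hypotheses
  (H_star : P Star)
  (H_arr : forall A u v, P A -> Q u -> Q v -> P (Arr A u v))
  (H_inv : forall A t, P A -> Q t -> P (Inv A t))
  (H_var : forall i, Q (Var i))
  (H_coh : forall G A g, All P G -> P A -> All Q g -> Q (Coh G A g))
  (H_can : forall t es, Q t -> All Q es -> Q (Can t es))
  (H_coind : forall t tl tr tlu tru tilu tiru,
     Q t -> Q tl -> Q tr -> Q tlu -> Q tru -> Q tilu -> Q tiru ->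
     Q (Coind t tl tr tlu tru tilu tiru))
  (H_rec : forall t tl tr tlu tru tilu tiru g,
     Q t -> Q tl -> Q tr -> Q tlu -> Q tru -> Q tilu -> Q tiru -> All Q g ->
     Q (Rec t tl tr tlu tru tilu tiru g))
  (H_des : forall d e, Q e -> Q (Des d e)).

Fixpoint ty_rect_All (A : ty) : P A :=
  match A with
  | Star => H_star
  | Arr A u v => H_arr (ty_rect_All A) (tm_rect_All u) (tm_rect_All v)
  | Inv A t => H_inv (ty_rect_All A) (tm_rect_All t)
  end
with tm_rect_All (t : tm) : Q t :=
  let all_ty := fix all_ty (s : seq ty) : All P s :=
    if s is x :: s' then conj (ty_rect_All x) (all_ty s') else I in
  let all_tm := fix all_tm (s : seq tm) : All Q s :=
    if s is x :: s' then conj (tm_rect_All x) (all_tm s') else I in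
  match t with
  | Var i => H_var i
  | Coh G A g => H_coh (all_ty G) (ty_rect_All A) (all_tm g)
  | Can t es => H_can (tm_rect_All t) (all_tm es)
  | Coind t tl tr tlu tru tilu tiru =>
      H_coind (tm_rect_All t) (tm_rect_All tl) (tm_rect_All tr)
        (tm_rect_All tlu) (tm_rect_All tru) (tm_rect_All tilu)
        (tm_rect_All tiru)
  | Rec t tl tr tlu tru tilu tiru g =>
      H_rec (tm_rect_All t) (tm_rect_All tl) (tm_rect_All tr) (tm_rect_All tlu)
        (tm_rect_All tru) (tm_rect_All tilu) (tm_rect_All tiru) (all_tm g)
  | Des d e => H_des d (tm_rect_All e)
  end.

Lemma syntax_ind : (forall A, P A) /\ (forall t, Q t).
Proof. by split; [exact: ty_rect_All | exact: tm_rect_All]. Qed.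

End SyntaxInduction.

(** Substitutions act only on the last argument of a coherence or a recursor,
   and then the types need no induction hypothesis. *)
Lemma tm_All_ind (Q : tm -> Prop) :
  (forall i, Q (Var i)) ->
  (forall G A g, All Q g -> Q (Coh G A g)) ->
  (forall t es, Q t -> All Q es -> Q (Can t es)) ->
  (forall t tl tr tlu tru tilu tiru,
     Q t -> Q tl -> Q tr -> Q tlu -> Q tru -> Q tilu -> Q tiru ->
     Q (Coind t tl tr tlu tru tilu tiru)) ->
  (forall t tl tr tlu tru tilu tiru g, All Q g ->
     Q (Rec t tl tr tlu tru tilu tiru g)) ->
  (forall d e, Q e -> Q (Des d e)) ->
  forall t, Q t.
Proof.
move=> Hv Hco Hca Hci Hr Hd.
by apply: (syntax_ind (P := fun=> True) (Q := Q) _ _ _ _ _ _ _ _ _).2; auto.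
Qed.

Lemma All_map_eq (T U : Type) (f h : T -> U) (s : seq T) :
  All (fun t => f t = h t) s -> map f s = map h s.
Proof. by elim: s => //= x s IH [-> /IH ->]. Qed.

Lemma All_nth (T : Type) (x0 : T) (P : T -> Prop) (s : seq T) (i : nat) :
  All P s -> i < size s -> P (nth x0 s i).
Proof. by elim: s i => //= x s IH [|i] [Px /IH]; last exact. Qed.

Lemma nth_map_junk (f : tm -> tm) (s : sub) i :
  f junk = junk -> nth junk (map f s) i = f (nth junk s i).
Proof.
move=> fj; have [lt_i|ge_i] := ltnP i (size s); first exact: nth_map.
by rewrite !nth_default ?size_map.
Qed.

Lemma subst_tm_comp s g t :
  subst_tm s (subst_tm g t) = subst_tm (comp_sub g s) t.
Proof.
rewrite /comp_sub; elim/tm_All_ind: t => /=.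
- by move=> i; rewrite nth_map_junk.
- by move=> G A h IH; rewrite -map_comp; congr Coh; apply: All_map_eq.
- by move=> t es -> IH; rewrite -map_comp; congr Can; apply: All_map_eq.
- by move=> ? ? ? ? ? ? ? -> -> -> -> -> -> ->.
- by move=> ? ? ? ? ? ? ? h IH; rewrite -map_comp; congr Rec; apply: All_map_eq.
- by move=> d e ->.
Qed.

Lemma subst_ty_comp s g A :
  subst_ty s (subst_ty g A) = subst_ty (comp_sub g s) A.
Proof.
elim: A => //= [A IH u v|A IH t]; first by rewrite IH !subst_tm_comp.
by rewrite IH subst_tm_comp.
Qed.

Lemma comp_sub_cat g h s : comp_sub (g ++ h) s = comp_sub g s ++ comp_sub h s.
Proof. exact: map_cat. Qed.

Lemma comp_sub_comp g h s :
  comp_sub (comp_sub g h) s = comp_sub g (comp_sub h s).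
Proof.
by rewrite /comp_sub -map_comp; apply: eq_map => t /=; rewrite subst_tm_comp.
Qed.

Lemma size_vars n : size (vars n) = n.
Proof. by rewrite size_map size_iota. Qed.

Lemma varsS n : vars n.+1 = rcons (vars n) (Var n).
Proof. by rewrite /vars -addn1 iotaD map_cat cats1. Qed.

Lemma nth_vars n i : i < n -> nth junk (vars n) i = Var i.
Proof. by move=> lt_i; rewrite (nth_map 0) ?size_iota // nth_iota. Qed.

Lemma comp_vars_cat n s s' : size s = n -> comp_sub (vars n) (s ++ s') = s.
Proof.
move=> sz; apply: (@eq_from_nth _ junk) => [|i]; rewrite size_map size_vars //.
move=> lt_i; rewrite (nth_map junk) ?size_vars // nth_vars //=.
by rewrite nth_cat sz lt_i.
Qed.

(** * Scoping *)

Definition scoped (n : nat) (t : tm) : bool := all (fun i => i < n) (fv_tm t).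
Definition scoped_ty (n : nat) (A : ty) : bool :=
  all (fun i => i < n) (fv_ty A).

Lemma all_flatten_map (T U : Type) (p : pred U) (f : T -> seq U) (s : seq T) :
  all p (flatten (map f s)) = all (fun x => all p (f x)) s.
Proof. by elim: s => //= x s IH; rewrite all_cat IH. Qed.

Lemma eq_subst_tm n s s' t :
  (forall i, i < n -> nth junk s i = nth junk s' i) ->
  scoped n t -> subst_tm s t = subst_tm s' t.
Proof.
move=> eq_s; have E g :
  All (fun t => scoped n t -> subst_tm s t = subst_tm s' t) g ->
  all (scoped n) g -> map (subst_tm s) g = map (subst_tm s') g.
  by elim: g => //= r g IH [Hr /IH Hg] /andP[/Hr -> /Hg ->].
elim/tm_All_ind: t => /=.
- by move=> i; rewrite /scoped /= andbT; apply: eq_s.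
- by move=> G A g IH; rewrite /scoped /= all_flatten_map => /(E _ IH) ->.
- move=> t es IHt IH; rewrite /scoped /= all_cat all_flatten_map.
  by case/andP=> /IHt -> /(E _ IH) ->.
- move=> t tl tr tlu tru tilu tiru H1 H2 H3 H4 H5 H6 H7.
  rewrite /scoped /= !all_cat.
  by case/and5P=> /H1 -> /H2 -> /H3 -> /H4 -> /and3P[/H5 -> /H6 -> /H7 ->].
- move=> ? ? ? ? ? ? ? g IH.
  by rewrite /scoped /= all_flatten_map => /(E _ IH) ->.
- by move=> d e IH /IH ->.
Qed.

Lemma eq_subst_ty n s s' A :
  (forall i, i < n -> nth junk s i = nth junk s' i) ->
  scoped_ty n A -> subst_ty s A = subst_ty s' A.
Proof.
move=> eq_s; rewrite /scoped_ty; elim: A => //= [A IH u v|A IH t].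
  rewrite !all_cat => /and3P[/IH -> Hu Hv].
  by rewrite !(eq_subst_tm eq_s).
by rewrite all_cat => /andP[/IH -> Ht]; rewrite (eq_subst_tm eq_s).
Qed.

Lemma subst_tm_vars n t : scoped n t -> subst_tm (vars n) t = t.
Proof.
have E g : All (fun t => scoped n t -> subst_tm (vars n) t = t) g ->
  all (scoped n) g -> map (subst_tm (vars n)) g = g.
  by elim: g => //= u g IH [Hu /IH Hg] /andP[/Hu -> /Hg ->].
elim/tm_All_ind: t => /=.
- by move=> i; rewrite /scoped /= andbT; apply: nth_vars.
- by move=> G A g IH; rewrite /scoped /= all_flatten_map => /(E _ IH) ->.
- move=> t es IHt IH; rewrite /scoped /= all_cat all_flatten_map.
  by case/andP=> /IHt -> /(E _ IH) ->.
- move=> t tl tr tlu tru tilu tiru H1 H2 H3 H4 H5 H6 H7.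
  rewrite /scoped /= !all_cat.
  by case/and5P=> /H1 -> /H2 -> /H3 -> /H4 -> /and3P[/H5 -> /H6 -> /H7 ->].
- move=> ? ? ? ? ? ? ? g IH.
  by rewrite /scoped /= all_flatten_map => /(E _ IH) ->.
- by move=> d e IH /IH ->.
Qed.

Lemma subst_ty_vars n A : scoped_ty n A -> subst_ty (vars n) A = A.
Proof.
rewrite /scoped_ty; elim: A => //= [A IH u v|A IH t].
  by rewrite !all_cat => /and3P[/IH -> Hu Hv]; rewrite !subst_tm_vars.
by rewrite all_cat => /andP[/IH -> Ht]; rewrite subst_tm_vars.
Qed.

(** Variables of t outside the range of s become closed terms. *)
Lemma scoped_subst_tm m s t : all (scoped m) s -> scoped m (subst_tm s t).
Proof.
move=> Hs; have E g : All (fun t => scoped m (subst_tm s t)) g ->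
  all (fun i => i < m) (flatten (map fv_tm (map (subst_tm s) g))).
  by rewrite all_flatten_map; elim: g => //= r g IH [Hr /IH ->]; rewrite andbT.
elim/tm_All_ind: t => /=; rewrite /scoped /=.
- move=> i; have [lt_i|ge_i] := ltnP i (size s).
    exact: (all_nthP junk Hs).
  by rewrite nth_default.
- by move=> G A g /E.
- by move=> t es Ht /E; rewrite all_cat => ->; rewrite andbT.
- move=> t tl tr tlu tru tilu tiru *; rewrite !all_cat.
  by apply/and5P; split=> //; apply/and3P.
- by move=> *; apply: E.
- by [].
Qed.

Lemma scoped_Arr n A u v :
  scoped_ty n (Arr A u v) = [&& scoped_ty n A, scoped n u & scoped n v].
Proof. by rewrite /scoped_ty /= !all_cat. Qed.

Lemma scoped_Inv n A t : scoped_ty n (Inv A t) = scoped_ty n A && scoped n t.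
Proof. by rewrite /scoped_ty /= !all_cat. Qed.

Lemma scoped_subst_ty m s A : all (scoped m) s -> scoped_ty m (subst_ty s A).
Proof.
move=> Hs; elim: A => //= [A IH u v|A IH t].
  by rewrite scoped_Arr IH !scoped_subst_tm.
by rewrite scoped_Inv IH scoped_subst_tm.
Qed.

Lemma scoped_bdry n A : scoped_ty n A -> all (scoped n) (bdry A).
Proof.
elim: A => //= A IH u v; rewrite scoped_Arr => /and3P[/IH HA Hu Hv].
by rewrite all_cat HA /= Hu Hv.
Qed.

Lemma scoped_coh_at n A G T args :
  scoped_ty n A -> all (scoped n) args -> scoped n (coh_at A G T args).
Proof.
by move=> /scoped_bdry HA Ha; rewrite /scoped /= all_flatten_map all_cat HA.
Qed.

Lemma scoped_destr_ty n d A u v t e :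
  scoped_ty n (Inv (Arr A u v) t) -> scoped n e ->
  scoped_ty n (destr_ty d A u v t e).
Proof.
rewrite scoped_Inv scoped_Arr => /andP[/and3P[HA Hu Hv] Ht] He.
have He' d' : scoped n (Des d' e) by [].
by case: d; rewrite /= ?scoped_Inv ?scoped_Arr ?HA ?Hu ?Hv ?Ht ?He
  /compt /idt ?scoped_coh_at //= ?He' ?Hu ?Hv ?Ht.
Qed.

Lemma scoped_ty_le m n A : m <= n -> scoped_ty m A -> scoped_ty n A.
Proof. by move=> le_mn; apply: sub_all => i /leq_trans->. Qed.

(** * Substitution *)

Scheme wf_ctx_mind := Minimality for wf_ctx Sort Prop
  with wf_ty_mind := Minimality for wf_ty Sort Prop
  with wf_tm_mind := Minimality for wf_tm Sort Prop
  with wf_sub_mind := Minimality for wf_sub Sort Prop.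
Combined Scheme wf_mind from wf_ctx_mind, wf_ty_mind, wf_tm_mind, wf_sub_mind.


Definition scoped_ctx (G : ctx) : Prop :=
  forall i, i < size G -> scoped_ty i (nth Star G i).

(** The typing rule for arrows has no premise about the common type of the two
   ends, so the scoping of the type of a term is proved along with that of the
   term. *)
Lemma wf_scoped :
  (forall G, wf_ctx G -> scoped_ctx G) /\
  (forall G A, wf_ty G A -> scoped_ctx G /\ scoped_ty (size G) A) /\
  (forall G t A, wf_tm G t A ->
     [/\ scoped_ctx G, scoped (size G) t & scoped_ty (size G) A]) /\
  (forall D g G, wf_sub D g G ->
     [/\ scoped_ctx D, size g = size G & all (scoped (size D)) g]).
Proof.
apply: wf_mind => //=.
- move=> G A HA [HG IHA] i; rewrite size_rcons ltnS nth_rcons.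
  by case: ltngtP => // [/HG|->].
- by move=> G A u v _ _ [HG Hu HA] _ [_ Hv _]; rewrite scoped_Arr HA Hu.
- by move=> G A u v t _ [HG Ht HA]; rewrite scoped_Inv HA.
- move=> G i _ HG lt_i; rewrite /scoped /= lt_i.
  by split=> //; apply: scoped_ty_le (HG i lt_i); apply: ltnW.
- move=> D G A g _ _ _ _ _ [HD sz Hg]; split=> //; last exact: scoped_subst_ty.
  by rewrite /scoped /= all_flatten_map.
- by move=> G d A u v t e _ [HG He HA]; split=> //; exact: scoped_destr_ty.
- move=> G A x y t tl tr tlu tru tilu tiru _ [HG Ht HA].
  move=> _ [_ Htl _] _ [_ Htr _] _ [_ Htlu _] _ [_ Htru _].
  move=> _ [_ Htilu _] _ [_ Htiru _]; split=> //; last by rewrite scoped_Inv HA.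
  by rewrite /scoped /= !all_cat; apply/and5P; split=> //; apply/and3P.
- move=> D G A g es _ [HD Ht HA] _ _ Hes; rewrite scoped_Inv HA; split=> //.
  rewrite /scoped /= all_cat [all _ _]Ht /= all_flatten_map.
  by apply/(all_nthP junk) => j /Hes[].
- move=> G n A x y t tl tr tlu tru tilu tiru g.
  move=> _ _ _ _ _ _ _ _ _ _ _ _ _ _ _ [HG _ Hg]; split=> //.
    by rewrite /scoped /= all_flatten_map.
  by rewrite scoped_Inv scoped_Arr !scoped_subst_tm // scoped_subst_ty.
- by move=> G t A A' _ [HG Ht _] _ _ [_ HA'].
- move=> D g G A t _ [HD sz Hg] _ _ _ [_ Ht _].
  by rewrite !size_rcons sz all_rcons Ht.
Qed.

Lemma wf_ctx_scoped G : wf_ctx G -> scoped_ctx G.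
Proof. by case: wf_scoped => H _; apply: H. Qed.

Lemma wf_ty_scoped G A : wf_ty G A -> scoped_ty (size G) A.
Proof. by case: wf_scoped => _ [H _] /H[]. Qed.

Lemma wf_sub_size D g G : wf_sub D g G -> size g = size G.
Proof. by case: wf_scoped => _ [_ [_ H]] /H[]. Qed.

Lemma wf_sub_ctx D g G : wf_sub D g G -> wf_ctx D.
Proof. by elim. Qed.

Lemma subst_ty_prefix n s s' A :
  size s = n -> scoped_ty n A -> subst_ty (s ++ s') A = subst_ty s A.
Proof. by move=> sz; apply: eq_subst_ty => i lt_i; rewrite nth_cat sz lt_i. Qed.

Lemma wf_sub_nth D s G : wf_sub D s G -> forall i, i < size G ->
  wf_tm D (nth junk s i) (subst_ty s (nth Star G i)).
Proof.
elim=> // {}D g {}G A t Hg IH HA Ht i.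
have sz := wf_sub_size Hg; have HG := wf_sub_size Hg.
rewrite size_rcons ltnS -cats1 !nth_rcons nth_cat sz => le_i.
have [lt_i|gt_i|eq_i] := ltngtP i (size G); last 1 first.
- by rewrite eq_i subnn (subst_ty_prefix _ sz) // wf_ty_scoped.
- have {}HA := proj1 (proj1 (proj2 wf_scoped) _ _ HA).
  rewrite (subst_ty_prefix _ sz); first exact: IH.
  by apply: scoped_ty_le (HA i lt_i); apply: ltnW.
- by rewrite leqNgt gt_i in le_i.
Qed.

Lemma is_inv_subst s A : is_inv (subst_ty s A) = is_inv A.
Proof. by case: A. Qed.

Lemma tdim_subst s A : tdim (subst_ty s A) = tdim A.
Proof. by elim: A => //= A -> . Qed.

Lemma bdry_subst s A : bdry (subst_ty s A) = comp_sub (bdry A) s.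
Proof. by elim: A => //= A IH u v; rewrite comp_sub_cat IH. Qed.

Lemma coh_at_subst s A G T args :
  subst_tm s (coh_at A G T args) = coh_at (subst_ty s A) G T (comp_sub args s).
Proof.
by rewrite /coh_at /= tdim_subst bdry_subst map_cat.
Qed.

Lemma lunit_ty_subst s A u v t l :
  subst_ty s (lunit_ty A u v t l) =
  lunit_ty (subst_ty s A) (subst_tm s u) (subst_tm s v) (subst_tm s t)
    (subst_tm s l).
Proof. by apply: (f_equal3 Arr) => //; apply: coh_at_subst. Qed.

Lemma runit_ty_subst s A u v t r :
  subst_ty s (runit_ty A u v t r) =
  runit_ty (subst_ty s A) (subst_tm s u) (subst_tm s v) (subst_tm s t)
    (subst_tm s r).
Proof. by apply: (f_equal3 Arr) => //; apply: coh_at_subst. Qed.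

Lemma destr_ty_subst s d A u v t e :
  subst_ty s (destr_ty d A u v t e) =
  destr_ty d (subst_ty s A) (subst_tm s u) (subst_tm s v) (subst_tm s t)
    (subst_tm s e).
Proof.
have L := lunit_ty_subst s A u v t (linv e).
have R := runit_ty_subst s A u v t (rinv e).
by case: d => //; rewrite /destr_ty -?L -?R.
Qed.

Scheme wf_ty_eq_mind := Minimality for wf_ty Sort Prop
  with wf_tm_eq_mind := Minimality for wf_tm Sort Prop
  with wf_sub_eq_mind := Minimality for wf_sub Sort Prop
  with eq_ty_mind := Minimality for eq_ty Sort Prop
  with eq_tm_mind := Minimality for eq_tm Sort Prop
  with eq_sub_mind := Minimality for eq_sub Sort Prop.
Combined Scheme judgement_mind from wf_ty_eq_mind, wf_tm_eq_mind,
  wf_sub_eq_mind, eq_ty_mind, eq_tm_mind, eq_sub_mind.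

(** Equality is part of the induction because of the conversion rule.  The
   computation rules are stable since their right-hand sides are themselves
   substitution instances of terms of a fixed context. *)
Lemma judgement_subst :
  (forall G A, wf_ty G A ->
     forall D s, wf_sub D s G -> wf_ty D (subst_ty s A)) /\
  (forall G t A, wf_tm G t A ->
     forall D s, wf_sub D s G -> wf_tm D (subst_tm s t) (subst_ty s A)) /\
  (forall G g F, wf_sub G g F ->
     forall D s, wf_sub D s G -> wf_sub D (comp_sub g s) F) /\
  (forall G A B, eq_ty G A B ->
     forall D s, wf_sub D s G -> eq_ty D (subst_ty s A) (subst_ty s B)) /\
  (forall G t u, eq_tm G t u ->
     forall D s, wf_sub D s G -> eq_tm D (subst_tm s t) (subst_tm s u)) /\
  (forall G g h, eq_sub G g h ->
     forall D s, wf_sub D s G -> eq_sub D (comp_sub g s) (comp_sub h s)).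
Proof.
apply: judgement_mind.
- by move=> G HG D s /wf_sub_ctx; constructor.
- move=> G A u v HA _ IHu _ IHv D s Hs.
  by apply: wf_ty_arr; rewrite ?is_inv_subst //; [apply: IHu | apply: IHv].
- by move=> G A u v t _ IH D s Hs; apply: wf_ty_inv; apply: IH.
- by move=> G i _ lt_i D s Hs; apply: wf_sub_nth.
- move=> F G A g ps_G HA _ full_A _ IHg D s Hs.
  by rewrite subst_ty_comp; apply: wf_tm_coh => //; apply: IHg.
- move=> G d A u v t e _ IH D s Hs.
  by rewrite destr_ty_subst; apply: wf_tm_des; apply: IH.
- move=> G A x y t tl tr tlu tru tilu tiru.
  move=> _ H1 _ H2 _ H3 _ H4 _ H5 _ H6 _ H7 D s Hs.
  have E B r : subst_ty s (Inv B r) = Inv (subst_ty s B) (subst_tm s r) by [].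
  move: (H4 _ _ Hs) (H5 _ _ Hs) (H6 _ _ Hs) (H7 _ _ Hs).
  rewrite !E lunit_ty_subst runit_ty_subst => *.
  by apply: wf_tm_coind => //; [apply: H1 | apply: H2 | apply: H3].
- move=> F G A g es _ IHt sz _ IHes D s Hs.
  move: (IHt _ _ Hs); rewrite /= !subst_ty_comp => Ht.
  apply: wf_tm_can => //; rewrite size_map // => j lt_j.
  by move: (IHes j lt_j _ _ Hs); rewrite subst_ty_comp (nth_map junk).
- move=> G n A x y t tl tr tlu tru tilu tiru g.
  move=> Ht _ Htl _ Htr _ Htlu _ Htru _ Htilu _ Htiru _ _ IHg D s Hs.
  rewrite subst_ty_comp.
  by apply: (wf_tm_rec Ht Htl Htr Htlu Htru Htilu Htiru); apply: IHg.
- move=> G t A A' _ Ht _ eqA _ HA' D s Hs.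
  by apply: wf_tm_conv (Ht _ _ Hs) (eqA _ _ Hs) (HA' _ _ Hs).
- by move=> D _ D' s /wf_sub_ctx; constructor.
- move=> D g G A t _ IHg HA _ _ IHt D' s Hs.
  rewrite /comp_sub map_rcons; apply: wf_sub_ext HA _; first exact: IHg.
  by rewrite -subst_ty_comp; apply: IHt.
- by move=> *; apply: eq_ty_refl.
- by move=> G A B _ IH D s Hs; apply: eq_ty_sym; apply: IH.
- move=> G A B C _ IH1 _ IH2 D s Hs.
  by apply: eq_ty_trans (IH1 _ _ Hs) (IH2 _ _ Hs).
- by move=> G A A' u u' v v' _ IHA _ IHu _ IHv D s Hs; apply: eq_ty_arr; auto.
- by move=> G A A' t t' _ IHA _ IHt D s Hs; apply: eq_ty_inv; auto.
- by move=> *; apply: eq_tm_refl.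
- by move=> G t t' _ IH D s Hs; apply: eq_tm_sym; apply: IH.
- move=> G t1 t2 t3 _ IH1 _ IH2 D s Hs.
  by apply: eq_tm_trans (IH1 _ _ Hs) (IH2 _ _ Hs).
- move=> F G G' A A' g g' eqG eqA _ _ IHg D s Hs.
  by apply: eq_tm_coh => //; apply: IHg.
- by move=> G d e e' _ IH D s Hs; apply: eq_tm_des; auto.
- by move=> *; apply: eq_tm_coind; auto.
- move=> G t t' es es' _ IHt _ IHes D s Hs.
  by apply: eq_tm_can; [apply: IHt | apply: IHes].
- move=> G n T t tl tr tlu tru tilu tiru g t' tl' tr' tlu' tru' tilu' tiru' g'.
  move=> _ IHg Ht _ e1 _ e2 _ e3 _ e4 _ e5 _ e6 _ e7 _ _ IHgg D s Hs.
  by apply: (eq_tm_rec _ Ht e1 e2 e3 e4 e5 e6 e7); [apply: IHg | apply: IHgg].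
- by move=> G T t e _ IH D s Hs; apply: eq_tm_eta; apply: IH Hs.
- move=> G T r d t tl tr tlu tru tilu tiru _ IH D s Hs.
  by move: (eq_tm_coind_beta d (IH _ _ Hs)); case: (d).
- move=> F T r d G C u v g es _ IH D s Hs.
  move: (eq_tm_can_beta d (IH _ _ Hs)).
  by rewrite /can_beta subst_tm_comp comp_sub_cat.
- move=> G n T r d t tl tr tlu tru tilu tiru g _ IH _ IHg D s Hs.
  move: (eq_tm_rec_beta d (IH _ _ Hs) (IHg _ _ Hs)).
  by case: d; rewrite /rec_beta !subst_tm_comp ?comp_sub_comp.
- by move=> *; apply: eq_sub_nil.
- move=> G t t' g g' _ IHt _ IHg D s Hs.
  by apply: eq_sub_cons; [apply: IHt | apply: IHg].
Qed.

Lemma wf_tm_subst G t A D s :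
  wf_tm G t A -> wf_sub D s G -> wf_tm D (subst_tm s t) (subst_ty s A).
Proof. by move=> Ht; apply: (proj1 (proj2 judgement_subst)). Qed.

(** * Weakening and hereditary validity *)

Lemma wf_ctx_rcons G A : wf_ctx (rcons G A) -> wf_ty G A.
Proof.
move eF: (rcons G A) => F HF; case: F / HF eF => [|F B HB].
  by case: G.
by case/rcons_inj=> -> ->.
Qed.

Lemma wf_ctxP :
  (forall G, wf_ctx G -> True) /\
  (forall G A, wf_ty G A -> wf_ctx G) /\
  (forall G t A, wf_tm G t A -> wf_ctx G) /\
  (forall D g G, wf_sub D g G -> wf_ctx D).
Proof. by apply: wf_mind. Qed.

Lemma wf_ty_ctx G A : wf_ty G A -> wf_ctx G.
Proof. exact: (proj1 (proj2 wf_ctxP)). Qed.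

Lemma wf_ctx_nth G i :
  wf_ctx G -> i < size G -> wf_ty (take i G) (nth Star G i).
Proof.
elim/last_ind: G i => // G A IH i /wf_ctx_rcons HA.
rewrite size_rcons ltnS -cats1 nth_cat take_cat.
case: ltngtP => // [lt_i|->] _; first exact: IH (wf_ty_ctx HA) lt_i.
by rewrite subnn take0 cats0.
Qed.

(** A term of a context is unchanged in a longer one, so weakening is
   substitution by variables. *)
Lemma wf_sub_vars D k : wf_ctx D -> k <= size D -> wf_sub D (vars k) (take k D).
Proof.
move=> HD; elim: k => [|k IH] lt_k; first by rewrite take0; constructor.
have HA := wf_ctx_nth HD lt_k.
rewrite varsS (take_nth Star) //; apply: wf_sub_ext (IH (ltnW lt_k)) HA _.
rewrite subst_ty_vars; first exact: wf_tm_var.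
exact: wf_ctx_scoped.
Qed.

Definition is_arr (A : ty) : bool := if A is Arr _ _ _ then true else false.

(** Inverting a typing derivation does not give access to the boundary of a
   boundary; here the whole tower of iterated boundaries is required to be well
   typed, and recursion on the type replaces repeated inversion. *)
Fixpoint valid (G : ctx) (T : ty) : Prop :=
  match T with
  | Star => wf_ctx G
  | Arr A u v => [/\ ~~ is_inv A, valid G A, wf_tm G u A & wf_tm G v A]
  | Inv A t => [/\ is_arr A, valid G A & wf_tm G t A]
  end.

Lemma valid_wf G T : valid G T -> wf_ty G T.
Proof.
case: T => /= [|A u v|A t]; first exact: wf_ty_star.
  by case=> ? _; apply: wf_ty_arr.
by case: A => [|A u v|A r] [] // _ _; apply: wf_ty_inv.
Qed.

Lemma valid_ctx G T : valid G T -> wf_ctx G.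
Proof. by move/valid_wf/wf_ty_ctx. Qed.

Lemma valid_subst G D s T : valid G T -> wf_sub D s G -> valid D (subst_ty s T).
Proof.
move=> HT Hs.
elim: T HT => /= [_|A IH u v [HA /IH ? Hu Hv]|A IH t [HA /IH ? Ht]].
- exact: wf_sub_ctx Hs.
- by rewrite is_inv_subst; split=> //; apply: wf_tm_subst Hs.
- by split=> //; [case: (A) HA | apply: wf_tm_subst Hs].
Qed.

Lemma valid_weak G G' T : valid G T -> wf_ctx (G ++ G') -> valid (G ++ G') T.
Proof.
move=> HT HG; rewrite -(subst_ty_vars (wf_ty_scoped (valid_wf HT))).
apply: valid_subst HT _.
have /(wf_sub_vars HG) : size G <= size (G ++ G') by rewrite size_cat leq_addr.
by rewrite take_size_cat.
Qed.

(** * Iterated suspension *)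

(** The boundary of the k-disk: what k suspensions add to a context. *)
Definition sphere (k : nat) : ctx := iter k susp_ctx [::].

Lemma iter_susp_ctx k G :
  iter k susp_ctx G = sphere k ++ map (iter k susp_ty) G.
Proof.
elim: k => [|k IH]; first by rewrite map_id.
rewrite [LHS]iterS IH /susp_ctx map_cat -map_comp.
by rewrite [sphere k.+1]iterS.
Qed.

Lemma size_sphere k : size (sphere k) = k.*2.
Proof. by elim: k => //= k IH; rewrite size_map IH. Qed.

Lemma size_iter_susp k G : size (iter k susp_ctx G) = k.*2 + size G.
Proof. by rewrite iter_susp_ctx size_cat size_sphere size_map. Qed.

Lemma sphereS k : sphere k.+1 = sphere k ++ [:: disk_ty k; disk_ty k].
Proof. by rewrite /sphere iterSr iter_susp_ctx. Qed.

Lemma iter_susp_Arr k A u v : iter k susp_ty (Arr A u v) =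
  Arr (iter k susp_ty A) (iter k susp_tm u) (iter k susp_tm v).
Proof. by elim: k => //= k ->. Qed.

Lemma iter_susp_Var k i : iter k susp_tm (Var i) = Var (k.*2 + i).
Proof. by elim: k => //= k ->. Qed.

Lemma iter_susp_Coh k G A g : iter k susp_tm (Coh G A g) =
  Coh (iter k susp_ctx G) (iter k susp_ty A)
    (vars k.*2 ++ map (iter k susp_tm) g).
Proof.
elim: k => [|k IH]; first by rewrite map_id.
rewrite [LHS]iterS IH /= map_cat -map_comp; congr Coh.
congr [:: _, _ & _ ++ _].
by rewrite /vars (iotaDl 2 0) -!map_comp.
Qed.

Lemma disk_tyS k :
  disk_ty k.+1 = Arr (disk_ty k) (Var k.*2) (Var k.*2.+1).
Proof.
by rewrite /disk_ty iterSr iter_susp_Arr !iter_susp_Var addn0 addn1.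
Qed.

Lemma tdim_disk k : tdim (disk_ty k) = k.
Proof. by elim: k => // k IH; rewrite disk_tyS /= IH. Qed.

Lemma bdry_disk k : bdry (disk_ty k) = vars k.*2.
Proof.
by elim: k => // k IH; rewrite disk_tyS /= IH doubleS !varsS -!cats1 -catA.
Qed.

Lemma is_inv_disk k : ~~ is_inv (disk_ty k).
Proof. by case: k => // k; rewrite disk_tyS. Qed.

Lemma valid_disk k : valid (sphere k) (disk_ty k).
Proof.
elim: k => [|k IH]; first exact: wf_ctx_nil.
have W1 : wf_ctx (sphere k ++ [:: disk_ty k]).
  by rewrite cats1; apply: wf_ctx_ext; apply: valid_wf.
have V1 := valid_weak IH W1.
have W2 : wf_ctx (sphere k ++ [:: disk_ty k; disk_ty k]).
  rewrite -cat_rcons cats1; apply: wf_ctx_ext.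
  by rewrite -cats1; apply: valid_wf.
rewrite sphereS disk_tyS; split; first exact: is_inv_disk.
- exact: valid_weak W2.
- have /(wf_tm_var W2) : k.*2 < size (sphere k ++ [:: disk_ty k; disk_ty k]).
    by rewrite size_cat size_sphere addn2.
  by rewrite nth_cat size_sphere ltnn subnn.
- have /(wf_tm_var W2) : k.*2.+1 < size (sphere k ++ [:: disk_ty k; disk_ty k]).
    by rewrite size_cat size_sphere addn2.
  by rewrite nth_cat size_sphere ltnNge leqnSn /= subSnn.
Qed.

Lemma size_bdry A : size (bdry A) = (tdim A).*2.
Proof. by elim: A => //= A IH u v; rewrite size_cat IH addn2. Qed.

Lemma nth_bdry_cat A s i :
  nth junk (bdry A ++ s) ((tdim A).*2 + i) = nth junk s i.
Proof. by rewrite nth_cat size_bdry ltnNge leq_addr addKn. Qed.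

Fixpoint arrow_ty (A : ty) : bool :=
  match A with
  | Star => true
  | Arr A _ _ => arrow_ty A
  | Inv _ _ => false
  end.

Lemma valid_arrow G A : valid G A -> ~~ is_inv A -> arrow_ty A.
Proof. by elim: A => //= A IH u v [iA /IH]; auto. Qed.

(** The disk type is the universal type without Inv: any other is its instance
   at its own boundary. *)
Lemma subst_disk A s :
  arrow_ty A -> subst_ty (bdry A ++ s) (disk_ty (tdim A)) = A.
Proof.
elim: A s => // A IH u v s HA; rewrite [tdim _]/= disk_tyS /= -catA IH //.
have := nth_bdry_cat A [:: u, v & s] 1; have := nth_bdry_cat A [:: u, v & s] 0.
by rewrite addn0 addn1 => -> ->.
Qed.

Lemma wf_sub_bdry D A :
  valid D A -> ~~ is_inv A -> wf_sub D (bdry A) (sphere (tdim A)).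
Proof.
elim: A => [HD _|A IH u v [iA VA Hu Hv] _|//]; first exact: wf_sub_nil.
have aA := valid_arrow VA iA; have Vk := valid_disk (tdim A).
have W1 : wf_ctx (sphere (tdim A) ++ [:: disk_ty (tdim A)]).
  by rewrite cats1; apply: wf_ctx_ext; apply: valid_wf.
have W2 := valid_weak Vk W1.
rewrite [tdim _]/= sphereS -cat_rcons cats1 /= -cat_rcons cats1.
have E s : subst_ty (bdry A ++ s) (disk_ty (tdim A)) = A by apply: subst_disk.
apply: wf_sub_ext; [apply: wf_sub_ext| |].
- exact: IH.
- exact: valid_wf.
- by rewrite -(cats0 (bdry A)) E.
- by rewrite -cats1; apply: valid_wf.
- by rewrite -cats1 E.
Qed.

(** * Suspension of pasting diagrams and full types *)

Lemma ps_susp G x A :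
  ps G x A -> ps (susp_ctx G) (susp_tm x) (susp_ty A).
Proof.
elim=> {G x A} [|G f A x y _ /= /ps_drop //|G x A _].
  exact: (ps_ext ps_point).
by move/ps_ext; rewrite /susp_ctx map_cat /= size_map.
Qed.

Fixpoint var_targets (A : ty) : Prop :=
  match A with
  | Star => True
  | Arr A _ v => (exists i, v = Var i) /\ var_targets A
  | Inv _ _ => False
  end.

(** A pasting diagram is required to end in a variable, which survives the
   drops after a suspension only because all targets are variables. *)
Lemma ps_var G x A : ps G x A -> (exists i, x = Var i) /\ var_targets A.
Proof.
elim=> {G x A} [|G f A x y _ [_ []] //|G x A _ [_ vA]].
  by split=> //; exists 0.
by split; [exists (size G).+1 | split=> //; exists (size G)].
Qed.

(** Dropping to the target until dimension 0 ends any partial diagram. *)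
Lemma ps_pasting G x A : ps G x A -> pasting G.
Proof.
elim: A x => [|A IH u v|A IH t] x H.
- by case: (ps_var H) => [[i eq_x] _]; exists i; rewrite -eq_x.
- exact: IH (ps_drop H).
- by case: (ps_var H).
Qed.

Lemma pasting_susp G : pasting G -> pasting (susp_ctx G).
Proof. by case=> i /ps_susp /ps_pasting. Qed.

Lemma pasting_iter_susp k G : pasting G -> pasting (iter k susp_ctx G).
Proof. by move=> ps_G; elim: k => //= k /pasting_susp. Qed.

Lemma arrow_susp A : arrow_ty (susp_ty A) = arrow_ty A.
Proof. by elim: A. Qed.

Lemma tdim_susp A : arrow_ty A -> tdim (susp_ty A) = (tdim A).+1.
Proof. by elim: A => //= A IH u v /IH ->. Qed.

Lemma cdim_susp G :
  0 < size G -> all arrow_ty G -> cdim (susp_ctx G) = (cdim G).+1.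
Proof.
rewrite /cdim /= !max0n; elim: G => //= A [|B G] IH _ /andP[aA aG].
  by rewrite /= tdim_susp // !maxn0.
by rewrite IH // tdim_susp // maxnSS.
Qed.

Lemma fv_susp_tm i t : i \in fv_tm t -> i.+2 \in fv_tm (susp_tm t).
Proof.
have E g : All (fun t => i \in fv_tm t -> i.+2 \in fv_tm (susp_tm t)) g ->
    i \in flatten (map fv_tm g) ->
    i.+2 \in flatten (map fv_tm (map susp_tm g)).
  elim: g => //= r g IH [Hr /IH Hg]; rewrite !mem_cat.
  by case/orP=> [/Hr|/Hg] ->; rewrite ?orbT.
elim/tm_All_ind: t => /=.
- by move=> j; rewrite !inE.
- by move=> G A g /E IH /IH; rewrite !inE => ->; rewrite !orbT.
- move=> t es IHt /E IH; rewrite !mem_cat.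
  by case/orP=> [/IHt|/IH] ->; rewrite ?orbT.
- move=> t tl tr tlu tru tilu tiru H1 H2 H3 H4 H5 H6 H7.
  by rewrite !mem_cat => /or4P[/H1|/H2|/H3|/or4P[/H4|/H5|/H6|/H7]] ->;
    rewrite ?orbT.
- by move=> ? ? ? ? ? ? ? g /E IH /IH; rewrite !inE => ->; rewrite !orbT.
- by [].
Qed.

Lemma fv_susp_ty i A : i \in fv_ty A -> i.+2 \in fv_ty (susp_ty A).
Proof.
elim: A => //= [A IH u v|A IH t]; rewrite !mem_cat.
  by case/or3P=> [/IH|/fv_susp_tm|/fv_susp_tm] ->; rewrite ?orbT.
by case/orP=> [/IH|/fv_susp_tm] ->; rewrite ?orbT.
Qed.

(** Every suspended type sits over the two new points, so the fullness
   conditions on these are automatic. *)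
Lemma fv_susp_base i A : i < 2 -> i \in fv_ty (susp_ty A).
Proof.
move=> lt_i; elim: A => /= [|A IH u v|A IH t]; rewrite ?mem_cat ?IH //.
by case: i lt_i => [|[|]].
Qed.

Lemma uses_susp A t i : uses A t i -> uses (susp_ty A) (susp_tm t) i.+2.
Proof. by case/orP=> [/fv_susp_tm|/fv_susp_ty] H; rewrite /uses H ?orbT. Qed.

Lemma uses_susp_base A t i : i < 2 -> uses (susp_ty A) (susp_tm t) i.
Proof. by move=> lt_i; rewrite /uses fv_susp_base ?orbT. Qed.

Lemma vdim_susp G i :
  all arrow_ty G -> i < size G -> vdim (susp_ctx G) i.+2 = (vdim G i).+1.
Proof.
move=> /(all_nthP Star) aG lt_i.
by rewrite /vdim /= (nth_map Star) // tdim_susp // aG.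
Qed.

Lemma is_var_susp i t : is_var i.+2 (susp_tm t) = is_var i t.
Proof. by case: t. Qed.

Lemma source_var_susp G i : source_var (susp_ctx G) i.+2 = source_var G i.
Proof.
rewrite /source_var /= has_map; congr (~~ _); apply: eq_has => -[] //= A u v.
exact: is_var_susp.
Qed.

Lemma target_var_susp G i : target_var (susp_ctx G) i.+2 = target_var G i.
Proof.
rewrite /target_var /= has_map; congr (~~ _); apply: eq_has => -[] //= A u v.
exact: is_var_susp.
Qed.

Lemma full_susp G T : 0 < size G -> all arrow_ty G -> arrow_ty T ->
  full G T -> full (susp_ctx G) (susp_ty T).
Proof.
case: T => // A u v nzG aG aA; rewrite /full /= size_map (iotaDl 2 0) !all_map.
have H t i := @uses_susp_base A t i.
rewrite !H //= !implybT /=; case/orP=> [U|/and3P[/eqP dimG /allP Us /allP Ut]].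
  apply/orP; left; apply: sub_all U => i /andP[/uses_susp Hu /uses_susp Hv].
  by rewrite /= add2n Hu.
apply/orP; right; rewrite tdim_susp // dimG cdim_susp // eqxx /=.
apply/andP; split; apply/allP=> i Hi; rewrite /= add2n;
  (have lt_i : i < size G by [move: Hi; rewrite mem_iota]);
  rewrite vdim_susp // -dimG ltnS ?source_var_susp ?target_var_susp;
  apply/implyP=> Hd; apply: uses_susp.
  by apply: (implyP (Us i Hi)).
by apply: (implyP (Ut i Hi)).
Qed.

Lemma full_iter_susp k G T : 0 < size G -> all arrow_ty G -> arrow_ty T ->
  full G T -> full (iter k susp_ctx G) (iter k susp_ty T).
Proof.
move=> nzG aG aT fT; elim: k => //= k; apply: full_susp.
- by rewrite size_iter_susp addn_gt0 nzG orbT.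
- elim: k => //= k; rewrite all_map; apply: sub_all => A.
  by rewrite /= arrow_susp.
- by elim: k => //= k; rewrite arrow_susp.
Qed.

(** * Well-typed CaTT terms at every suspension level *)

Definition drop_end (p : tm * ty) : tm * ty :=
  if p.2 is Arr A _ y then (y, A) else p.

(** A recognizer of pasting diagrams that computes.  The next cell is attached
   in dimension tdim B, so the number of targets to drop before it is determined
   by the dimensions. *)
Fixpoint pd_ext (n : nat) (x : tm) (A : ty) (l : seq ty) : Prop :=
  match l with
  | [::] => True
  | B :: C :: l' =>
      let p := iter (tdim A - tdim B) drop_end (x, A) in
      [/\ p.2 = B, C = Arr B p.1 (Var n) & pd_ext n.+2 (Var n.+1) C l']
  | _ => False
  end.

Definition pd (G : ctx) : Prop :=
  if G is Star :: l then pd_ext 1 (Var 0) Star l else False.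

Lemma pd_ext_pasting G x A l :
  ps G x A -> pd_ext (size G) x A l -> pasting (G ++ l).
Proof.
have [n] := ubnP (size l); elim: n G x A l => // n IH G x A.
case=> [|B [|C l]] //= lt_n psG.
  by rewrite cats0 => _; apply: ps_pasting psG.
set p := iter _ _ _ => -[pB -> Hl].
have psp : ps G p.1 p.2.
  rewrite /p; elim: (_ - _) => //= m; case: (iter _ _ _) => y [|D a b|D t] //=.
  exact: ps_drop.
rewrite -[_ :: _]/([:: B; Arr B p.1 (Var (size G))] ++ l) catA.
have := ps_ext psp; rewrite pB => /IH; apply; first by rewrite -ltnS ltnW.
by rewrite size_cat addn2.
Qed.

Lemma pd_pasting G : pd G -> pasting G.
Proof.
case: G => [|[|//|//] l] // Hl.
by apply: (@pd_ext_pasting [:: Star]) ps_point Hl.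
Qed.

Lemma pd_nonempty G : pd G -> 0 < size G.
Proof. by case: G. Qed.

Definition infer (G : ctx) (t : tm) : ty :=
  match t with
  | Var i => nth Star G i
  | Coh _ T g => subst_ty g T
  | _ => Star
  end.

(** Typing of the terms built from variables and coherences only, as a
   recursive proposition: on concrete syntax it reduces to a conjunction of
   trivial equations.  The substitution g of a coherence occurs twice in
   catt_sub, once as the list traversed and once as the substitution applied to
   the types. *)
Fixpoint catt_ty (G : ctx) (A : ty) : Prop :=
  match A with
  | Star => True
  | Arr A u v =>
      [/\ catt_ty G A, catt_tm G u, catt_tm G v, infer G u = A & infer G v = A]
  | Inv _ _ => False
  end
with catt_tm (G : ctx) (t : tm) : Prop :=
  let fix catt_ctx pre F : Prop :=
    if F is B :: F' then catt_ty pre B /\ catt_ctx (rcons pre B) F' else True in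
  let fix catt_sub g g0 F : Prop :=
    match g, F with
    | [::], [::] => True
    | r :: g', B :: F' =>
        [/\ catt_tm G r, infer G r = subst_ty g0 B & catt_sub g' g0 F']
    | _, _ => False
    end in
  match t with
  | Var i => i < size G
  | Coh F T g =>
      [/\ pd F, full F T, catt_ctx [::] F, catt_ty F T & catt_sub g g F]
  | _ => False
  end.

Fixpoint catt_ctx (pre F : ctx) : Prop :=
  if F is B :: F' then catt_ty pre B /\ catt_ctx (rcons pre B) F' else True.
Definition catt_sub (G : ctx) :=
  fix catt_sub (g g0 : sub) (F : ctx) : Prop :=
    match g, F with
    | [::], [::] => True
    | r :: g', B :: F' =>
        [/\ catt_tm G r, infer G r = subst_ty g0 B & catt_sub g' g0 F']
    | _, _ => False
    end.

Definition catt_coh (F : ctx) (T : ty) : Prop :=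
  [/\ pd F, full F T, catt_ctx [::] F & catt_ty F T].

Lemma catt_Coh G F T g :
  catt_tm G (Coh F T g) <-> catt_coh F T /\ catt_sub G g g F.
Proof. by split=> [[? ? ? ? ?]|[[? ? ? ?] ?]]. Qed.

Lemma catt_ctx_nth pre F i : catt_ctx pre F -> i < size F ->
  catt_ty (pre ++ take i F) (nth Star F i).
Proof.
elim: F i pre => //= B F IH [|i] pre [HB HF] lt_i; first by rewrite cats0.
by rewrite -cat_rcons; apply: IH.
Qed.

Lemma catt_subP G g g0 F : catt_sub G g g0 F ->
  size g = size F /\ forall i, i < size F ->
    catt_tm G (nth junk g i) /\
    infer G (nth junk g i) = subst_ty g0 (nth Star F i).
Proof.
elim: g F => [|r g IH] [|B F] //= [Hr Er /IH[-> Hg]].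
by split=> // -[|i]; last exact: Hg.
Qed.

Lemma catt_arrow G A : catt_ty G A -> arrow_ty A.
Proof. by elim: A => //= A IH u v [/IH]. Qed.

Lemma catt_ctx_arrow pre F : catt_ctx pre F -> all arrow_ty F.
Proof. by elim: F pre => //= B F IH pre [/catt_arrow -> /IH]. Qed.

(** inst_tm A s t is t suspended until its objects have the type A, with s
   substituted for its variables; inst_tmE relates it to iterated suspension. *)
Fixpoint inst_tm (A : ty) (s : sub) (t : tm) : tm :=
  match t with
  | Var i => nth junk s i
  | Coh G T g => coh_at A G T (map (inst_tm A s) g)
  | _ => junk
  end.

Fixpoint inst_ty (A : ty) (s : sub) (T : ty) : ty :=
  match T with
  | Arr B u v => Arr (inst_ty A s B) (inst_tm A s u) (inst_tm A s v)
  | _ => A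
  end.

Lemma catt_sub_All Q G g F : catt_sub G g g F ->
  All (fun t => catt_tm G t -> Q t) g -> All Q g.
Proof.
move: {2}g => g0; elim: g F => //= r g IH [|B F] //= [Hr _ Hg] [/(_ Hr) ? Hall].
by split=> //; apply: IH Hg Hall.
Qed.

Lemma catt_tm_ind G (Q : tm -> Prop) :
  (forall i, i < size G -> Q (Var i)) ->
  (forall F T g,
     catt_coh F T -> catt_sub G g g F -> All Q g -> Q (Coh F T g)) ->
  forall t, catt_tm G t -> Q t.
Proof.
move=> Hv Hc; elim/tm_All_ind => //= F T g IH /catt_Coh[HF Hg].
by apply: Hc => //; apply: catt_sub_All Hg IH.
Qed.

Lemma catt_ty_ind G (Q : tm -> Prop) (P : ty -> Prop) :
  (forall t, catt_tm G t -> Q t) -> P Star ->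
  (forall A u v, P A -> Q u -> Q v -> P (Arr A u v)) ->
  forall A, catt_ty G A -> P A.
Proof.
by move=> HQ Hs Ha; elim=> //= A IH u v [/IH HA /HQ Hu /HQ Hv _ _]; apply: Ha.
Qed.

Lemma inst_tmE A s G t : arrow_ty A -> catt_tm G t ->
  subst_tm (bdry A ++ s) (iter (tdim A) susp_tm t) = inst_tm A s t.
Proof.
move=> aA; elim/catt_tm_ind => {t} [i _|F T g _ _ IH].
  by rewrite iter_susp_Var /= nth_bdry_cat.
rewrite iter_susp_Coh /= map_cat -map_comp (All_map_eq IH).
by congr Coh; congr (_ ++ _); apply: comp_vars_cat; rewrite size_bdry.
Qed.

Lemma inst_tyE A s G T : arrow_ty A -> catt_ty G T ->
  subst_ty (bdry A ++ s) (iter (tdim A) susp_ty T) = inst_ty A s T.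
Proof.
move=> aA; move: T.
apply: (catt_ty_ind (fun t => @inst_tmE A s G t aA)) => /= [|T u v IH Eu Ev].
  exact: subst_disk.
by rewrite iter_susp_Arr /= IH Eu Ev.
Qed.

Lemma inst_tm_subst A s G g t : size G <= size g -> catt_tm G t ->
  inst_tm A s (subst_tm g t) = inst_tm A (map (inst_tm A s) g) t.
Proof.
move=> sz; elim/catt_tm_ind => {t} /= [i lt_i|F T h _ _ IH].
  by rewrite (nth_map junk) // (leq_trans lt_i).
by rewrite -map_comp (All_map_eq IH).
Qed.

Lemma inst_ty_subst A s G g T : size G <= size g -> catt_ty G T ->
  inst_ty A s (subst_ty g T) = inst_ty A (map (inst_tm A s) g) T.
Proof.
move=> sz; move: T.
apply: (catt_ty_ind (fun t => @inst_tm_subst A s G g t sz)) => //= T u v.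
by move=> -> -> ->.
Qed.

Lemma inst_tm_prefix A s s' G t : size G <= size s -> catt_tm G t ->
  inst_tm A (s ++ s') t = inst_tm A s t.
Proof.
move=> sz; elim/catt_tm_ind => {t} /= [i lt_i|F T g _ _ IH].
  by rewrite nth_cat (leq_trans lt_i).
by rewrite (All_map_eq IH).
Qed.

Lemma inst_ty_prefix A s s' G T : size G <= size s -> catt_ty G T ->
  inst_ty A (s ++ s') T = inst_ty A s T.
Proof.
move=> sz; move: T.
apply: (catt_ty_ind (fun t => @inst_tm_prefix A s s' G t sz)) => //= T u v.
by move=> -> -> ->.
Qed.

Definition susp_vars (k n : nat) : sub := [seq Var (k.*2 + i) | i <- iota 0 n].

(** Iterated suspension is itself an instance: at the disk type, with the
   variables of the suspended context as arguments.  Hence inst_wf also gives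
   the stability of typing under suspension. *)
Lemma inst_tm_susp k n G t : size G <= n -> catt_tm G t ->
  inst_tm (disk_ty k) (susp_vars k n) t = iter k susp_tm t.
Proof.
move=> le_n; elim/catt_tm_ind => {t} /= [i lt_i|F T g _ _ IH].
  have lt_n := leq_trans lt_i le_n.
  by rewrite (nth_map 0) ?size_iota // nth_iota // iter_susp_Var.
by rewrite iter_susp_Coh /coh_at tdim_disk bdry_disk (All_map_eq IH).
Qed.

Lemma inst_ty_susp k n G T : size G <= n -> catt_ty G T ->
  inst_ty (disk_ty k) (susp_vars k n) T = iter k susp_ty T.
Proof.
move=> le_n; move: T.
apply: (catt_ty_ind (fun t => @inst_tm_susp k n G t le_n)) => //= T u v.
by rewrite iter_susp_Arr => -> -> ->.
Qed.

Definition args_ok (D : ctx) (A : ty) (s : sub) (G : ctx) : Prop :=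
  size s = size G /\ forall i, i < size G ->
    wf_tm D (nth junk s i) (inst_ty A s (nth Star G i)).

Definition inst_wf_ty (T : ty) : Prop := forall G, catt_ty G T ->
  forall D A s, valid D A -> ~~ is_inv A -> args_ok D A s G ->
  wf_ty D (inst_ty A s T).

Definition inst_wf_tm (t : tm) : Prop := forall G, catt_tm G t ->
  forall D A s, valid D A -> ~~ is_inv A -> args_ok D A s G ->
  wf_tm D (inst_tm A s t) (inst_ty A s (infer G t)).

Lemma iter_susp_ctx_rcons k G B :
  iter k susp_ctx (rcons G B) = rcons (iter k susp_ctx G) (iter k susp_ty B).
Proof. by rewrite !iter_susp_ctx map_rcons rcons_cat. Qed.

Lemma args_ok_susp k G : catt_ctx [::] G -> wf_ctx (iter k susp_ctx G) ->
  args_ok (iter k susp_ctx G) (disk_ty k) (susp_vars k (size G)) G.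
Proof.
move=> okG HG; split=> [|i lt_i]; first by rewrite size_map size_iota.
have okB := catt_ctx_nth okG lt_i.
rewrite (inst_ty_susp _ _ okB); last by rewrite size_take lt_i ltnW.
rewrite (nth_map 0) ?size_iota // nth_iota //.
have /(wf_tm_var HG) : k.*2 + i < size (iter k susp_ctx G).
  by rewrite size_iter_susp ltn_add2l.
rewrite iter_susp_ctx nth_cat size_sphere ltnNge leq_addr addKn.
by rewrite (nth_map Star).
Qed.

Lemma valid_disk_susp k G :
  wf_ctx (iter k susp_ctx G) -> valid (iter k susp_ctx G) (disk_ty k).
Proof. by rewrite iter_susp_ctx; apply: valid_weak (valid_disk k). Qed.

Lemma wf_susp_ty k G B : inst_wf_ty B -> catt_ctx [::] G -> catt_ty G B ->
  wf_ctx (iter k susp_ctx G) -> wf_ty (iter k susp_ctx G) (iter k susp_ty B).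
Proof.
move=> IB okG okB HG; rewrite -(inst_ty_susp k (leqnn _) okB).
apply: IB okB _ _ _ (valid_disk_susp HG) (is_inv_disk k) _.
exact: args_ok_susp.
Qed.

Lemma catt_ctx_rcons pre G B :
  catt_ctx pre (rcons G B) <-> catt_ctx pre G /\ catt_ty (pre ++ G) B.
Proof.
elim: G pre => [|C G IH] pre /=; first by rewrite cats0; split=> [[]|[_ ?]].
rewrite -cat_rcons; split=> [[? /IH[]]|[[? ?] ?]] //.
by split=> //; apply/IH.
Qed.

Lemma All_rcons (T : Type) (P : T -> Prop) s x :
  All P (rcons s x) <-> All P s /\ P x.
Proof.
elim: s => [|y s IH] /=; first by split=> [[]|[]].
by split=> [[? /IH[]]|[[? ?] ?]] //; split=> //; apply/IH.
Qed.

Lemma wf_susp_ctx k G : All inst_wf_ty G -> catt_ctx [::] G ->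
  wf_ctx (iter k susp_ctx G).
Proof.
elim/last_ind: G => [_ _|G B IH /All_rcons[HG HB] /catt_ctx_rcons[okG okB]].
  exact: valid_ctx (valid_disk k).
rewrite iter_susp_ctx_rcons; apply: wf_ctx_ext; apply: wf_susp_ty => //.
exact: IH.
Qed.

Lemma catt_ctx_elem G i : catt_ctx [::] G -> i < size G ->
  exists2 F, catt_ty F (nth Star G i) & size F <= size G.
Proof.
move=> okG lt_i; exists (take i G); first exact: (catt_ctx_nth okG).
by rewrite size_take lt_i ltnW.
Qed.

(** The arguments of an instance, preceded by the boundary of the base type,
   form a substitution into the suspended diagram. *)
Lemma wf_sub_susp D A s G : valid D A -> ~~ is_inv A ->
  All inst_wf_ty G -> catt_ctx [::] G -> args_ok D A s G ->
  wf_sub D (bdry A ++ s) (iter (tdim A) susp_ctx G).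
Proof.
move=> VA iA; have aA := valid_arrow VA iA.
elim/last_ind: G s => [|G B IH] s HallG okG [sz Hs].
  by rewrite (size0nil sz) cats0; apply: wf_sub_bdry.
case/lastP: s sz Hs => [|s t]; rewrite !size_rcons // => -[sz] Hs.
case/All_rcons: HallG okG => HG HB /catt_ctx_rcons[okG okB].
rewrite iter_susp_ctx_rcons -rcons_cat; apply: wf_sub_ext.
- apply: IH => //; split=> // i lt_i.
  have := Hs i (ltnW lt_i).
  rewrite !nth_rcons sz lt_i -cats1.
  have [F okF le_F] := catt_ctx_elem okG lt_i.
  by rewrite (inst_ty_prefix _ _ _ okF) // sz.
- apply: wf_susp_ty => //; exact: wf_susp_ctx.
- rewrite (inst_tyE _ aA okB).
  have := Hs _ (ltnSn _); rewrite !nth_rcons sz ltnn eqxx -cats1.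
  by rewrite (inst_ty_prefix _ _ _ okB) // sz.
Qed.

(** Suspension and substitution are treated in one induction: typing a
   coherence at the base type A needs its diagram and its type suspended, and
   these are the instances of the induction hypotheses at a disk type. *)
Lemma inst_wf :
  (forall T, inst_wf_ty T) /\ (forall t, inst_wf_tm t).
Proof.
apply: syntax_ind => //.
- by move=> G _ D A s /valid_wf.
- move=> B u v IB Iu Iv G /= [okB oku okv Eu Ev] D A s VA iA Hs /=.
  have := Iu _ oku _ _ _ VA iA Hs; have := Iv _ okv _ _ _ VA iA Hs.
  rewrite Eu Ev => Wv Wu; apply: wf_ty_arr => //.
  by case: (B) okB iA.
- by move=> B t _ _ G [].
- by move=> i G /= lt_i D A s _ _ [_ Hs]; apply: Hs.
- move=> F T g IF IT Ig G /catt_Coh[[pdF fF okF okT] okg] D A s VA iA Hs.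
  have aA := valid_arrow VA iA; have [szg Hg] := catt_subP okg.
  rewrite /= (inst_ty_subst _ _ _ okT) ?szg // -(inst_tyE _ aA okT).
  apply: wf_tm_coh.
  + by apply: pasting_iter_susp; apply: pd_pasting.
  + by apply: wf_susp_ty => //; apply: wf_susp_ctx.
  + apply: full_iter_susp fF; first exact: pd_nonempty.
      exact: catt_ctx_arrow okF.
    exact: catt_arrow okT.
  + apply: wf_sub_susp => //; split=> [|i lt_i]; first by rewrite size_map.
    have [okr Er] := Hg i lt_i; have lt_g : i < size g by rewrite szg.
    rewrite (nth_map junk) //; have [F' okB le_F'] := catt_ctx_elem okF lt_i.
    have := All_nth junk Ig lt_g _ okr _ _ _ VA iA Hs.
    by rewrite Er (inst_ty_subst _ _ _ okB) // szg.
- by move=> t es _ _ G [].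
- by move=> t tl tr tlu tru tilu tiru _ _ _ _ _ _ _ G [].
- by move=> t tl tr tlu tru tilu tiru g _ _ _ _ _ _ _ _ G [].
- by move=> d e _ G [].
Qed.

Lemma All_of (T : Type) (P : T -> Prop) s : (forall x, P x) -> All P s.
Proof. by move=> H; elim: s. Qed.

Lemma wf_coh_at D A G T s : catt_coh G T -> valid D A -> ~~ is_inv A ->
  args_ok D A s G -> wf_tm D (coh_at A G T s) (inst_ty A s T).
Proof.
move=> [pdG fG okG okT] VA iA Hs; have aA := valid_arrow VA iA.
rewrite -(inst_tyE _ aA okT).
have HG : All inst_wf_ty G by apply: All_of; case: inst_wf.
apply: wf_tm_coh.
- by apply: pasting_iter_susp; apply: pd_pasting.
- by apply: wf_susp_ty => //; [case: inst_wf | apply: wf_susp_ctx].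
- apply: full_iter_susp fG; [exact: pd_nonempty | exact: catt_ctx_arrow okG |].
  exact: catt_arrow okT.
- exact: wf_sub_susp.
Qed.

Lemma tdim_iter_susp k T : arrow_ty T -> tdim (iter k susp_ty T) = k + tdim T.
Proof.
move=> aT; elim: k => //= k IH; rewrite tdim_susp ?IH //.
by elim: k {IH} => //= k; rewrite arrow_susp.
Qed.

Lemma tops_susp d G : all arrow_ty G ->
  tops d.+1 (susp_ctx G) = [seq i.+2 | i <- tops d G].
Proof.
move=> aG; rewrite /tops /= size_map (iotaDl 2 0) filter_map; congr map.
apply: eq_in_filter => i; rewrite mem_iota => /= lt_i.
by rewrite add2n vdim_susp.
Qed.

Lemma arrow_iter_susp k G : all arrow_ty G -> all arrow_ty (iter k susp_ctx G).
Proof.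
move=> aG; elim: k => //= k; rewrite all_map; apply: sub_all => A.
by rewrite /= arrow_susp.
Qed.

Lemma tops_iter_susp k d G : all arrow_ty G ->
  tops (k + d) (iter k susp_ctx G) = [seq k.*2 + i | i <- tops d G].
Proof.
move=> aG; elim: k => [|k IH]; first by rewrite map_id.
rewrite addSn [iter _ _ _]iterS tops_susp ?arrow_iter_susp // IH -map_comp.
by apply: eq_map => i.
Qed.

Lemma wf_can_at D A G T s es : catt_coh G T -> valid D A -> ~~ is_inv A ->
  args_ok D A s G -> size es = size (tops (tdim T) G) ->
  (forall j, j < size es ->
     let i := nth 0 (tops (tdim T) G) j in
     wf_tm D (nth junk es j)
       (Inv (inst_ty A s (nth Star G i)) (nth junk s i))) ->
  wf_tm D (Can (coh_at A G T s) es) (Inv (inst_ty A s T) (coh_at A G T s)).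
Proof.
move=> ok VA iA Hs sz Hes; have [pdG fG okG okT] := ok.
have aA := valid_arrow VA iA; have aG := catt_ctx_arrow okG.
have Et : tops (tdim (iter (tdim A) susp_ty T)) (iter (tdim A) susp_ctx G) =
  [seq (tdim A).*2 + i | i <- tops (tdim T) G].
  by rewrite tdim_iter_susp ?(catt_arrow okT) // tops_iter_susp.
rewrite -(inst_tyE _ aA okT); apply: wf_tm_can; rewrite ?Et ?size_map //.
  by rewrite (inst_tyE _ aA okT); apply: wf_coh_at.
move=> j lt_j; have lt_t : j < size (tops (tdim T) G) by rewrite -sz.
have := Hes j lt_j; rewrite (nth_map 0) //; set i := nth 0 _ j => /=.
have lt_i : i < size G.
  have : i \in tops (tdim T) G by apply: mem_nth.
  by rewrite mem_filter mem_iota => /and3P[].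
rewrite nth_bdry_cat iter_susp_ctx nth_cat size_sphere ltnNge leq_addr addKn.
rewrite (nth_map Star) //; have [F okB _] := catt_ctx_elem okG lt_i.
by rewrite (inst_tyE _ aA okB).
Qed.

(** * Identities, composites and validity of typing *)

(** args_ok unrolled along the two lists, so that on concrete lists it computes
   to the conjunction of the typings required. *)
Fixpoint typed_args (D : ctx) (A : ty) (s0 s : sub) (G : ctx) : Prop :=
  match s, G with
  | [::], [::] => True
  | t :: s', B :: G' => wf_tm D t (inst_ty A s0 B) /\ typed_args D A s0 s' G'
  | _, _ => False
  end.

Lemma typed_args_ok D A s G : typed_args D A s s G -> args_ok D A s G.
Proof.
suff H s0 : typed_args D A s0 s G -> size s = size G /\ forall i, i < size G ->
    wf_tm D (nth junk s i) (inst_ty A s0 (nth Star G i)) by apply: H.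
elim: s G => [|t s IH] [|B G] //= [Ht /IH[-> Hs]].
by split=> // -[|i] //; apply: Hs.
Qed.

Ltac by_check := by vm_compute; repeat split.

Lemma catt_comp : catt_coh comp_ctx (Arr Star (Var 0) (Var 3)).
Proof. by_check. Qed.

Lemma catt_id : catt_coh [:: Star] (Arr Star (Var 0) (Var 0)).
Proof. by_check. Qed.

Section Ops.
Variables (D : ctx) (A : ty).
Hypotheses (VA : valid D A) (iA : ~~ is_inv A).

Lemma wf_idt x : wf_tm D x A -> wf_tm D (idt A x) (Arr A x x).
Proof.
by move=> Hx; apply: (wf_coh_at catt_id VA iA); apply: typed_args_ok.
Qed.

Lemma wf_compt x y z f g :
  wf_tm D x A -> wf_tm D y A -> wf_tm D z A ->
  wf_tm D f (Arr A x y) -> wf_tm D g (Arr A y z) ->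
  wf_tm D (compt A x y z f g) (Arr A x z).
Proof.
by move=> *; apply: (wf_coh_at catt_comp VA iA); apply: typed_args_ok.
Qed.

End Ops.

Lemma valid_lunit D A u v t l : valid D (Arr A u v) ->
  wf_tm D t (Arr A u v) -> wf_tm D l (Arr A v u) ->
  valid D (lunit_ty A u v t l).
Proof.
case=> iA VA Hu Hv Ht Hl; split=> //; first exact: wf_compt.
exact: wf_idt.
Qed.

Lemma valid_runit D A u v t r : valid D (Arr A u v) ->
  wf_tm D t (Arr A u v) -> wf_tm D r (Arr A v u) ->
  valid D (runit_ty A u v t r).
Proof.
case=> iA VA Hu Hv Ht Hl; split=> //; first exact: wf_compt.
exact: wf_idt.
Qed.

Lemma valid_destr D d A u v t e : valid D (Inv (Arr A u v) t) ->
  wf_tm D e (Inv (Arr A u v) t) -> valid D (destr_ty d A u v t e).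
Proof.
case=> _ VT Ht He; have Hl := wf_tm_des Linv He; have Hr := wf_tm_des Rinv He.
have VL := valid_lunit VT Ht Hl; have VR := valid_runit VT Ht Hr.
have [iA VA Hu Hv] := VT.
case: d => //; split=> //; first exact: (wf_tm_des Lunit He).
exact: (wf_tm_des Runit He).
Qed.

Definition valid_ctx_types (G : ctx) : Prop :=
  forall i, i < size G -> valid (take i G) (nth Star G i).

(** The type of a term is hereditarily valid.  Coherences, can and rec conclude
   with a substituted type, which uses valid_subst; the destructors conclude
   with types built from identities and composites over an arbitrary base, which
   uses the instances of the corresponding coherences.  The last component
   recovers, for the rule of can, that the type of a coherence is an arrow. *)
Lemma wf_valid :
  (forall G, wf_ctx G -> valid_ctx_types G) /\
  (forall G A, wf_ty G A -> valid_ctx_types G /\ valid G A) /\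
  (forall G t A, wf_tm G t A ->
     [/\ valid_ctx_types G, valid G A &
         if t is Coh _ B _ then is_arr B else true]) /\
  (forall D g G, wf_sub D g G -> valid_ctx_types D).
Proof.
apply: wf_mind => //.
- move=> G A HA [HG VA] i; rewrite size_rcons ltnS -cats1 nth_cat take_cat.
  case: ltngtP => // [lt_i|->] _; first exact: HG.
  by rewrite subnn take0 cats0.
- by move=> G A u v iA Hu [HG VA _] Hv _.
- by move=> G A u v t Ht [HG VT _]; split=> //; split.
- move=> G i HG V lt_i; split=> //; have := HG; rewrite -(cat_take_drop i G).
  by move/(valid_weak (V i lt_i)); rewrite cat_take_drop.
- move=> D G A g _ _ [_ VA] fA Hg VD; split=> //; first exact: valid_subst Hg.
  by case: (A) fA.
- by move=> G d A u v t e He [HG VT _]; split=> //; apply: valid_destr.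
- by move=> G A x y t tl tr tlu tru tilu tiru Ht [HG VT _] *; split=> //; split.
- move=> D G A g es Ht [VD VA aA] _ _ _; split=> //; split=> //.
  by case: (A) aA.
- move=> G n A x y t tl tr tlu tru tilu tiru g Ht [_ VT _].
  move=> _ _ _ _ _ _ _ _ _ _ _ _ Hg VG; split=> //.
  apply: (@valid_subst _ _ g (Inv (Arr A x y) t)) Hg.
  by split.
- by move=> G t A A' _ [HG _ at_] _ _ [_ VA'].
Qed.

Lemma wf_tm_valid G t A : wf_tm G t A -> valid G A.
Proof. by move=> Ht; have [] := proj1 (proj2 (proj2 wf_valid)) _ _ _ Ht. Qed.

(** * Cancelling a zigzag *)

Fixpoint typed_invs (D : ctx) (A : ty) (s : sub) (G : ctx)
    (ts : seq nat) (es : sub) : Prop :=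
  match ts, es with
  | [::], [::] => True
  | i :: ts', e :: es' =>
      wf_tm D e (Inv (inst_ty A s (nth Star G i)) (nth junk s i)) /\
      typed_invs D A s G ts' es'
  | _, _ => False
  end.

Lemma wf_can_at_typed D A G T s es : catt_coh G T -> valid D A -> ~~ is_inv A ->
  typed_args D A s s G -> typed_invs D A s G (tops (tdim T) G) es ->
  wf_tm D (Can (coh_at A G T s) es) (Inv (inst_ty A s T) (coh_at A G T s)).
Proof.
move=> ok VA iA /typed_args_ok Hs Hes.
have [sz {}Hes] : size es = size (tops (tdim T) G) /\ forall j, j < size es ->
    let i := nth 0 (tops (tdim T) G) j in
    wf_tm D (nth junk es j) (Inv (inst_ty A s (nth Star G i)) (nth junk s i)).
  elim: (tops _ _) es Hes => [|i ts IH] [|e es] //= [He /IH[-> Hes]].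
  by split=> // -[|j]; last exact: Hes.
exact: wf_can_at.
Qed.

Definition ar (i j : nat) : ty := Arr Star (Var i) (Var j).
Definition cmp (i j k : nat) (f g : tm) : tm :=
  compt Star (Var i) (Var j) (Var k) f g.

(** The coherences of the two composites, over their generic pasting diagrams.
   The only variables for which can asks an invertibility structure are the
   2-dimensional ones of the whiskerings: 6 in whisk_l_ctx and whisker_ctx, 4 in
   whisk_r_ctx. *)
Definition arrow_ctx : ctx := [:: Star; Star; ar 0 1].
Definition runit_inv_ty : ty :=
  Arr (ar 0 1) (Var 2) (cmp 0 1 1 (Var 2) (idt Star (Var 1))).
Definition lunit_inv_ty : ty :=
  Arr (ar 0 1) (Var 2) (cmp 0 0 1 (idt Star (Var 0)) (Var 2)).

Definition whisk_l_ctx : ctx :=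
  [:: Star; Star; ar 0 1; Star; ar 1 3; ar 1 3; Arr (ar 1 3) (Var 4) (Var 5)].
Definition whisk_l_ty : ty :=
  Arr (ar 0 3) (cmp 0 1 3 (Var 2) (Var 4)) (cmp 0 1 3 (Var 2) (Var 5)).

Definition whisk_r_ctx : ctx :=
  [:: Star; Star; ar 0 1; ar 0 1; Arr (ar 0 1) (Var 2) (Var 3); Star; ar 1 5].
Definition whisk_r_ty : ty :=
  Arr (ar 0 5) (cmp 0 1 5 (Var 2) (Var 6)) (cmp 0 1 5 (Var 3) (Var 6)).

Definition path4_ctx : ctx :=
  [:: Star; Star; ar 0 1; Star; ar 1 3; Star; ar 3 5; Star; ar 5 7].
Definition assoc4_ty : ty :=
  Arr (ar 0 7)
    (cmp 0 3 7 (cmp 0 1 3 (Var 2) (Var 4)) (cmp 3 5 7 (Var 6) (Var 8)))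
    (cmp 0 1 7 (Var 2) (cmp 1 5 7 (cmp 1 3 5 (Var 4) (Var 6)) (Var 8))).

Definition whisk_ty : ty :=
  Arr (ar 0 7)
    (cmp 0 1 7 (Var 2) (cmp 1 3 7 (Var 4) (Var 8)))
    (cmp 0 1 7 (Var 2) (cmp 1 3 7 (Var 5) (Var 8))).

Definition mid_unit_ty : ty :=
  Arr (ar 0 3)
    (cmp 0 1 3 (Var 2) (cmp 1 1 3 (idt Star (Var 1)) (Var 4)))
    (cmp 0 1 3 (Var 2) (Var 4)).

Definition path6_ctx : ctx := expand [:: Star] [:: 6].

Lemma catt_runit_inv : catt_coh arrow_ctx runit_inv_ty. Proof. by_check. Qed.
Lemma catt_lunit_inv : catt_coh arrow_ctx lunit_inv_ty. Proof. by_check. Qed.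
Lemma catt_whisk_l : catt_coh whisk_l_ctx whisk_l_ty. Proof. by_check. Qed.
Lemma catt_whisk_r : catt_coh whisk_r_ctx whisk_r_ty. Proof. by_check. Qed.
Lemma catt_assoc4 : catt_coh path4_ctx assoc4_ty. Proof. by_check. Qed.
Lemma catt_whisk : catt_coh whisker_ctx whisk_ty. Proof. by_check. Qed.
Lemma catt_mid_unit : catt_coh comp_ctx mid_unit_ty. Proof. by_check. Qed.
Lemma catt_path6 : catt_coh path6_ctx (ar 0 11). Proof. by_check. Qed.

Section Path6.
Variables (D : ctx) (A : ty).
Hypotheses (VA : valid D A) (iA : ~~ is_inv A).
Variables (x0 x1 x2 x3 x4 x5 x6 b1 b2 b3 b4 b5 b6 : tm).
Hypotheses
  (W1 : wf_tm D b1 (Arr A x0 x1)) (W2 : wf_tm D b2 (Arr A x1 x2))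
  (W3 : wf_tm D b3 (Arr A x2 x3)) (W4 : wf_tm D b4 (Arr A x3 x4))
  (W5 : wf_tm D b5 (Arr A x4 x5)) (W6 : wf_tm D b6 (Arr A x5 x6)).

Definition path6 : sub :=
  [:: x0; x1; b1; x2; b2; x3; b3; x4; b4; x5; b5; x6; b6].

Let typed_path6 : typed_args D A path6 path6 path6_ctx.
Proof.
have [[_ _ ? ?] [_ _ ? ?]] := (wf_tm_valid W1, wf_tm_valid W2).
have [[_ _ ? ?] [_ _ ? ?]] := (wf_tm_valid W4, wf_tm_valid W6).
by [].
Qed.

Lemma wf_path6 : wf_tm D (lcomp A path6) (Arr A x0 x6).
Proof. by apply: (wf_coh_at catt_path6 VA iA); apply: typed_args_ok. Qed.

Lemma wf_can_path6 e1 e2 e3 e4 e5 e6 :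
  wf_tm D e1 (Inv (Arr A x0 x1) b1) -> wf_tm D e2 (Inv (Arr A x1 x2) b2) ->
  wf_tm D e3 (Inv (Arr A x2 x3) b3) -> wf_tm D e4 (Inv (Arr A x3 x4) b4) ->
  wf_tm D e5 (Inv (Arr A x4 x5) b5) -> wf_tm D e6 (Inv (Arr A x5 x6) b6) ->
  wf_tm D (Can (lcomp A path6) [:: e1; e2; e3; e4; e5; e6])
    (Inv (Arr A x0 x6) (lcomp A path6)).
Proof. by move=> *; apply: (wf_can_at_typed catt_path6 VA iA). Qed.

End Path6.

(** Cells x -f-> y -g-> x -k-> y -h-> x with beta : g * k -> id y and
   gamma : f * h -> id x.  Such a zigzag gives
     (f * g) * (k * h) -> f * ((g * k) * h) -> f * (id y * h) -> f * h -> id x,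
   which is then preceded by a path into its source: from f * g when k * h comes
   with a cell from id x, and from k * h when f * g does.  These are the two
   cases of the theorem. *)
Section Zigzag.
Variables (D : ctx) (A : ty) (x y f g k h beta gamma : tm).
Hypotheses
  (Wf : wf_tm D f (Arr A x y)) (Wg : wf_tm D g (Arr A y x))
  (Wk : wf_tm D k (Arr A x y)) (Wh : wf_tm D h (Arr A y x)).

Let fg := compt A x y x f g.
Let gk := compt A y x y g k.
Let kh := compt A x y x k h.
Let fh := compt A x y x f h.
Let idx := idt A x.
Let idy := idt A y.

Hypotheses (Wbeta : wf_tm D beta (Arr (Arr A y y) gk idy))
  (Wgamma : wf_tm D gamma (Arr (Arr A x x) fh idx)).

Definition zigzag_assoc : tm :=
  coh_at A path4_ctx assoc4_ty [:: x; y; f; x; g; y; k; x; h].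
Definition zigzag_cancel : tm :=
  coh_at A whisker_ctx whisk_ty [:: x; y; f; y; gk; idy; beta; x; h].
Definition zigzag_unit : tm :=
  coh_at A comp_ctx mid_unit_ty [:: x; y; f; x; h].

Definition zigzag_path (x0 x1 b1 b2 : tm) : sub :=
  path6 x0 x1 (compt A x x x fg kh) (compt A x y x f (compt A y y x gk h))
    (compt A x y x f (compt A y y x idy h)) fh idx
    b1 b2 zigzag_assoc zigzag_cancel zigzag_unit gamma.

Definition zigzag_invs (e1 e2 ibeta igamma : tm) : sub :=
  [:: e1; e2; Can zigzag_assoc [::]; Can zigzag_cancel [:: ibeta];
      Can zigzag_unit [::]; igamma].

Let VA : valid D A. Proof. by have [] := wf_tm_valid Wf. Qed.
Let iA : ~~ is_inv A. Proof. by have [] := wf_tm_valid Wf. Qed.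
Let Wx : wf_tm D x A. Proof. by have [] := wf_tm_valid Wf. Qed.
Let Wy : wf_tm D y A. Proof. by have [] := wf_tm_valid Wf. Qed.
Let Wfg : wf_tm D fg (Arr A x x). Proof. exact: wf_compt. Qed.
Let Wgk : wf_tm D gk (Arr A y y). Proof. exact: wf_compt. Qed.
Let Wkh : wf_tm D kh (Arr A x x). Proof. exact: wf_compt. Qed.
Let Widx : wf_tm D idx (Arr A x x). Proof. exact: wf_idt. Qed.
Let Widy : wf_tm D idy (Arr A y y). Proof. exact: wf_idt. Qed.
Let VAx : valid D (Arr A x x). Proof. by []. Qed.

Section Head.
Variables (x0 x1 b1 b2 : tm).
Hypotheses (W1 : wf_tm D b1 (Arr (Arr A x x) x0 x1))
  (W2 : wf_tm D b2 (Arr (Arr A x x) x1 (compt A x x x fg kh))).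

Let total := lcomp (Arr A x x) (zigzag_path x0 x1 b1 b2).

Let W3 : wf_tm D zigzag_assoc (Arr (Arr A x x) (compt A x x x fg kh)
  (compt A x y x f (compt A y y x gk h))).
Proof. by apply: (wf_coh_at catt_assoc4 VA iA); apply: typed_args_ok. Qed.
Let W4 : wf_tm D zigzag_cancel (Arr (Arr A x x)
  (compt A x y x f (compt A y y x gk h))
  (compt A x y x f (compt A y y x idy h))).
Proof. by apply: (wf_coh_at catt_whisk VA iA); apply: typed_args_ok. Qed.
Let W5 : wf_tm D zigzag_unit (Arr (Arr A x x)
  (compt A x y x f (compt A y y x idy h)) fh).
Proof. by apply: (wf_coh_at catt_mid_unit VA iA); apply: typed_args_ok. Qed.

Lemma wf_zigzag : wf_tm D total (Arr (Arr A x x) x0 idx).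
Proof. exact: wf_path6. Qed.

Lemma wf_can_zigzag e1 e2 ibeta igamma :
  wf_tm D e1 (Inv (Arr (Arr A x x) x0 x1) b1) ->
  wf_tm D e2 (Inv (Arr (Arr A x x) x1 (compt A x x x fg kh)) b2) ->
  wf_tm D ibeta (Inv (Arr (Arr A y y) gk idy) beta) ->
  wf_tm D igamma (Inv (Arr (Arr A x x) fh idx) gamma) ->
  wf_tm D (Can total (zigzag_invs e1 e2 ibeta igamma))
    (Inv (Arr (Arr A x x) x0 idx) total).
Proof.
move=> We1 We2 Wib Wig; apply: wf_can_path6 => //.
- by apply: (wf_can_at_typed catt_assoc4 VA iA).
- by apply: (wf_can_at_typed catt_whisk VA iA).
- by apply: (wf_can_at_typed catt_mid_unit VA iA).
Qed.

End Head.

Section Left.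
Variable alpha : tm.
Hypothesis Walpha : wf_tm D alpha (Arr (Arr A x x) idx kh).

Let b1 := coh_at A arrow_ctx runit_inv_ty [:: x; x; fg].
Let b2 := coh_at A whisk_l_ctx whisk_l_ty [:: x; x; fg; x; idx; kh; alpha].

Definition zigzag_left : tm :=
  lcomp (Arr A x x) (zigzag_path fg (compt A x x x fg idx) b1 b2).
Definition zigzag_left_inv (ialpha ibeta igamma : tm) : tm :=
  Can zigzag_left (zigzag_invs (Can b1 [::]) (Can b2 [:: ialpha]) ibeta igamma).

Let Wb1 : wf_tm D b1 (Arr (Arr A x x) fg (compt A x x x fg idx)).
Proof. by apply: (wf_coh_at catt_runit_inv VA iA); apply: typed_args_ok. Qed.
Let Wb2 : wf_tm D b2
  (Arr (Arr A x x) (compt A x x x fg idx) (compt A x x x fg kh)).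
Proof. by apply: (wf_coh_at catt_whisk_l VA iA); apply: typed_args_ok. Qed.

Lemma wf_zigzag_left : wf_tm D zigzag_left (Arr (Arr A x x) fg idx).
Proof. exact: wf_zigzag Wb1 Wb2. Qed.

Lemma wf_zigzag_left_inv ialpha ibeta igamma :
  wf_tm D ialpha (Inv (Arr (Arr A x x) idx kh) alpha) ->
  wf_tm D ibeta (Inv (Arr (Arr A y y) gk idy) beta) ->
  wf_tm D igamma (Inv (Arr (Arr A x x) fh idx) gamma) ->
  wf_tm D (zigzag_left_inv ialpha ibeta igamma)
    (Inv (Arr (Arr A x x) fg idx) zigzag_left).
Proof.
move=> Wa Wb Wc; apply: (wf_can_zigzag Wb1 Wb2) => //.
- by apply: (wf_can_at_typed catt_runit_inv VA iA).
- by apply: (wf_can_at_typed catt_whisk_l VA iA).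
Qed.

End Left.

Section Right.
Variable alpha : tm.
Hypothesis Walpha : wf_tm D alpha (Arr (Arr A x x) idx fg).

Let b1 := coh_at A arrow_ctx lunit_inv_ty [:: x; x; kh].
Let b2 := coh_at A whisk_r_ctx whisk_r_ty [:: x; x; idx; fg; alpha; x; kh].

Definition zigzag_right : tm :=
  lcomp (Arr A x x) (zigzag_path kh (compt A x x x idx kh) b1 b2).
Definition zigzag_right_inv (ialpha ibeta igamma : tm) : tm :=
  Can zigzag_right
    (zigzag_invs (Can b1 [::]) (Can b2 [:: ialpha]) ibeta igamma).

Let Wb1 : wf_tm D b1 (Arr (Arr A x x) kh (compt A x x x idx kh)).
Proof. by apply: (wf_coh_at catt_lunit_inv VA iA); apply: typed_args_ok. Qed.
Let Wb2 : wf_tm D b2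
  (Arr (Arr A x x) (compt A x x x idx kh) (compt A x x x fg kh)).
Proof. by apply: (wf_coh_at catt_whisk_r VA iA); apply: typed_args_ok. Qed.

Lemma wf_zigzag_right : wf_tm D zigzag_right (Arr (Arr A x x) kh idx).
Proof. exact: wf_zigzag Wb1 Wb2. Qed.

Lemma wf_zigzag_right_inv ialpha ibeta igamma :
  wf_tm D ialpha (Inv (Arr (Arr A x x) idx fg) alpha) ->
  wf_tm D ibeta (Inv (Arr (Arr A y y) gk idy) beta) ->
  wf_tm D igamma (Inv (Arr (Arr A x x) fh idx) gamma) ->
  wf_tm D (zigzag_right_inv ialpha ibeta igamma)
    (Inv (Arr (Arr A x x) kh idx) zigzag_right).
Proof.
move=> Wa Wb Wc; apply: (wf_can_zigzag Wb1 Wb2) => //.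
- by apply: (wf_can_at_typed catt_lunit_inv VA iA).
- by apply: (wf_can_at_typed catt_whisk_r VA iA).
Qed.

End Right.
End Zigzag.

Section Cancellators.
Variables (D : ctx) (A : ty) (u v t e : tm).
Hypothesis We : wf_tm D e (Inv (Arr A u v) t).

Let Wt : wf_tm D t (Arr A u v). Proof. by have [] := wf_tm_valid We. Qed.
Let Wl : wf_tm D (linv e) (Arr A v u). Proof. exact: (wf_tm_des Linv We). Qed.
Let Wr : wf_tm D (rinv e) (Arr A v u). Proof. exact: (wf_tm_des Rinv We). Qed.
Let Wlu : wf_tm D (lunit e) (lunit_ty A u v t (linv e)).
Proof. exact: (wf_tm_des Lunit We). Qed.
Let Wru : wf_tm D (runit e) (runit_ty A u v t (rinv e)).
Proof. exact: (wf_tm_des Runit We). Qed.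
Let Wilu : wf_tm D (ilunit e) (Inv (lunit_ty A u v t (linv e)) (lunit e)).
Proof. exact: (wf_tm_des Ilunit We). Qed.
Let Wiru : wf_tm D (irunit e) (Inv (runit_ty A u v t (rinv e)) (runit e)).
Proof. exact: (wf_tm_des Irunit We). Qed.

(** The zigzag u -t-> v -l-> u -t-> v -r-> u. *)
Definition linv_unit : tm :=
  zigzag_left A u v t (linv e) t (rinv e) (lunit e) (runit e)
    (linv (irunit e)).
Definition linv_iunit (i : tm) : tm :=
  zigzag_left_inv A u v t (linv e) t (rinv e) (lunit e) (runit e)
    (linv (irunit e)) i (ilunit e) (irunit e).

(** The zigzag v -l-> u -t-> v -r-> u -t-> v. *)
Definition rinv_unit : tm :=
  zigzag_right A v u (linv e) t (rinv e) t (runit e) (lunit e)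
    (rinv (ilunit e)).
Definition rinv_iunit (i : tm) : tm :=
  zigzag_right_inv A v u (linv e) t (rinv e) t (runit e) (lunit e)
    (rinv (ilunit e)) i (irunit e) (ilunit e).

Lemma wf_linv_unit : wf_tm D linv_unit (lunit_ty A v u (linv e) t).
Proof. by apply: wf_zigzag_left => //; exact: (wf_tm_des Linv Wiru). Qed.

Lemma wf_linv_iunit i :
  wf_tm D i (Inv (Arr (Arr A u u) (idt A u) (compt A u v u t (rinv e)))
               (linv (irunit e))) ->
  wf_tm D (linv_iunit i) (Inv (lunit_ty A v u (linv e) t) linv_unit).
Proof.
by move=> Wi; apply: wf_zigzag_left_inv => //; exact: (wf_tm_des Linv Wiru).
Qed.

Lemma wf_rinv_unit : wf_tm D rinv_unit (runit_ty A v u (rinv e) t).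
Proof. by apply: wf_zigzag_right => //; exact: (wf_tm_des Rinv Wilu). Qed.

Lemma wf_rinv_iunit i :
  wf_tm D i (Inv (Arr (Arr A v v) (idt A v) (compt A v u v (linv e) t))
               (rinv (ilunit e))) ->
  wf_tm D (rinv_iunit i) (Inv (runit_ty A v u (rinv e) t) rinv_unit).
Proof.
by move=> Wi; apply: wf_zigzag_right_inv => //; exact: (wf_tm_des Rinv Wilu).
Qed.

End Cancellators.

(** * The universal invertible cell *)

Lemma diskE n : disk n = rcons (sphere n) (disk_ty n).
Proof. by rewrite /disk iter_susp_ctx cats1. Qed.

Lemma size_disk n : size (disk n) = n.*2.+1.
Proof. by rewrite diskE size_rcons size_sphere. Qed.

Lemma wf_disk n : wf_ctx (disk n).
Proof. by rewrite diskE; apply/wf_ctx_ext/valid_wf/valid_disk. Qed.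

Lemma size_einv n : size (einv n) = n.+1.*2.+2.
Proof. by rewrite size_rcons size_disk. Qed.

Lemma wf_einv n : wf_ctx (einv n).
Proof.
apply: wf_ctx_ext; rewrite disk_tyS; apply: wf_ty_inv; rewrite -disk_tyS.
have /(wf_tm_var (wf_disk n.+1)) : n.+1.*2 < size (disk n.+1).
  by rewrite size_disk.
by rewrite {2}diskE nth_rcons size_sphere ltnn eqxx.
Qed.

Lemma wf_einv_var n F : wf_ctx (einv n ++ F) ->
  wf_tm (einv n ++ F) (Var n.+1.*2.+1)
    (Inv (Arr (disk_ty n) (Var n.*2) (Var n.*2.+1)) (Var n.+1.*2)).
Proof.
move=> HF; rewrite -disk_tyS.
have /(wf_tm_var HF) : n.+1.*2.+1 < size (einv n ++ F).
  by rewrite size_cat size_einv addSn ltnS leq_addr.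
by rewrite nth_cat size_einv leqnn nth_rcons size_disk ltnn eqxx.
Qed.

Lemma wf_sub_chi_inv G A u v t e : wf_tm G e (Inv (Arr A u v) t) ->
  wf_sub G (chi_inv (Arr A u v) t e) (einv (tdim A)).
Proof.
move=> We; have [_ _ Wt] := wf_tm_valid We.
have VT : valid G (Arr A u v) := wf_tm_valid Wt; have aT := valid_arrow VT isT.
rewrite /chi_inv -cat_rcons cats1; apply: wf_sub_ext.
- rewrite -cats1; apply: (wf_sub_susp (G := [:: Star])) => //.
    by apply: All_of; case: inst_wf.
  by split=> // -[].
- exact: wf_ctx_rcons (wf_einv (tdim A)).
rewrite -cats1 [subst_ty _ _]/= (subst_disk _ aT).
by have := nth_bdry_cat (Arr A u v) [:: t] 0; rewrite addn0 /= => ->.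
Qed.

(** In a disk the type of an inverse exchanges the last two boundary variables.
   Substituting the boundary of a cell a -c-> b with structure i gives back the
   type of its inverse; this computes the types of h^- and h^+ as well as the
   conclusion of the recursor. *)
Lemma subst_chi_flip d B a b c i : arrow_ty B ->
  subst_ty (bdry B ++ [:: a; b; c; i])
    (Inv (Arr (disk_ty (tdim B)) (Var (tdim B).*2.+1) (Var (tdim B).*2))
       (Des d (Var (tdim B).*2.+3))) = Inv (Arr B b a) (Des d i).
Proof.
move=> aB; have E j := nth_bdry_cat B [:: a; b; c; i] j.
rewrite /= subst_disk //; have := (E 0, E 1, E 3).
by rewrite addn0 addn1 addn3 /= => -[[-> ->] ->].
Qed.

Definition inverse_destr (d : destr) : bool :=
  match d with Linv | Rinv => true | _ => false end.

Lemma wf_tm_inverse D d A u v t e : inverse_destr d ->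
  wf_tm D e (Inv (Arr A u v) t) -> wf_tm D (Des d e) (Arr A v u).
Proof.
case: d => // _ We; first exact: (wf_tm_des Linv We).
exact: (wf_tm_des Rinv We).
Qed.

Section Universal.
Variable n : nat.

Let A := disk_ty n.
Let u := Var n.*2.
Let v := Var n.*2.+1.
Let t := Var n.+1.*2.
Let e := Var n.+1.*2.+1.

(** The hypotheses h^- and h^+ of E^{n+1}_t when t is the inverse d of the
   generic cell: the same inverse of its units is invertible. *)
Definition hyp_l (d : destr) : ty :=
  Inv (Arr (Arr A v v) (idt A v) (compt A v u v (linv e) t)) (Des d (ilunit e)).
Definition hyp_r (d : destr) : ty :=
  Inv (Arr (Arr A u u) (idt A u) (compt A u v u t (rinv e))) (Des d (irunit e)).

Let susp_flip d : Inv (susp_ty (Arr A v u)) (susp_tm (Des d e)) =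
  Inv (Arr (disk_ty n.+1) (Var n.+1.*2.+1) (Var n.+1.*2))
    (Des d (Var n.+1.*2.+3)).
Proof. by []. Qed.

Let aA w : arrow_ty (Arr A w w).
Proof. by rewrite /A; elim: (n) => // m; rewrite disk_tyS. Qed.

Lemma einv_extE d :
  einv_ext n (Arr A v u) (Des d e) = einv n ++ [:: hyp_l d; hyp_r d].
Proof.
have tA : tdim A = n := tdim_disk n.
rewrite /einv_ext !susp_flip; congr (_ ++ [:: _; _]).
  rewrite /chi_ilunit /chi_unit disk_tyS /chi_inv -catA.
  have := subst_chi_flip d (compt A v u v (linv e) t) (idt A v) (lunit e)
    (ilunit e) (aA v).
  by rewrite [tdim _]/= tA -/(hyp_l d) => <-; rewrite -!catA disk_tyS.
rewrite /chi_irunit /chi_unit disk_tyS /chi_inv -catA.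
have := subst_chi_flip d (compt A u v u t (rinv e)) (idt A u) (runit e)
  (irunit e) (aA u).
by rewrite [tdim _]/= tA -/(hyp_r d) => <-; rewrite -!catA disk_tyS.
Qed.

Lemma wf_hyp_l_ty D d : inverse_destr d ->
  wf_tm D e (Inv (Arr A u v) t) -> wf_ty D (hyp_l d).
Proof.
move=> dP We; apply: wf_ty_inv; apply: (wf_tm_inverse dP).
exact: (wf_tm_des Ilunit We).
Qed.

Lemma wf_hyp_r_ty D d : inverse_destr d ->
  wf_tm D e (Inv (Arr A u v) t) -> wf_ty D (hyp_r d).
Proof.
move=> dP We; apply: wf_ty_inv; apply: (wf_tm_inverse dP).
exact: (wf_tm_des Irunit We).
Qed.

Lemma wf_einv_gen : wf_tm (einv n) e (Inv (Arr A u v) t).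
Proof.
by have := @wf_einv_var n [::]; rewrite cats0; apply; apply: wf_einv.
Qed.

Section Extension.
Variable d : destr.
Hypothesis dP : inverse_destr d.

Let E := einv n ++ [:: hyp_l d; hyp_r d].

Lemma wf_einv_ext : wf_ctx E.
Proof.
rewrite /E -cat_rcons cats1; apply: wf_ctx_ext; rewrite -cats1.
apply: wf_hyp_r_ty => //; apply: wf_einv_var; rewrite cats1.
by apply: wf_ctx_ext; apply: wf_hyp_l_ty => //; apply: wf_einv_gen.
Qed.

Lemma wf_hyp_l : wf_tm E (Var n.+1.*2.+2) (hyp_l d).
Proof.
have := wf_tm_var wf_einv_ext (i := n.+1.*2.+2).
by rewrite nth_cat size_cat size_einv addn2 ltnn subnn; apply.
Qed.

Lemma wf_hyp_r : wf_tm E (Var n.+1.*2.+3) (hyp_r d).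
Proof.
have := wf_tm_var wf_einv_ext (i := n.+1.*2.+3).
rewrite size_cat size_einv addn2 => /(_ (ltnSn _)).
by rewrite nth_cat size_einv ltnNge leqnSn subSnn.
Qed.

Lemma wf_ext_gen : wf_tm E e (Inv (Arr A u v) t).
Proof. by apply: wf_einv_var; apply: wf_einv_ext. Qed.

End Extension.
End Universal.

Theorem proposition5p2 (G : ctx) (A : ty) (u v t e : tm) :
  wf_ctx G ->
  wf_tm G t (Arr A u v) ->
  wf_tm G e (Inv (Arr A u v) t) ->
  invertible G A v u (linv e) /\ invertible G A v u (rinv e).
Proof.
move=> _ _ We; have Hs := wf_sub_chi_inv We.
have aA : arrow_ty A.
  have [_ VT _] := wf_tm_valid We; exact: (@valid_arrow G (Arr A u v)).
set n := tdim A in Hs.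
have Wn := wf_einv_gen n; have [_ _ Wt] := wf_tm_valid Wn.
have E d : subst_ty (chi_inv (Arr A u v) t e)
    (Inv (Arr (disk_ty n) (Var n.*2.+1) (Var n.*2)) (Des d (Var n.+1.*2.+1))) =
  Inv (Arr A v u) (Des d e).
  by rewrite /chi_inv /= -catA /= doubleS; apply: subst_chi_flip.
(* In both recursors t_l and t_r are the generic cell.  One of the two units is
   the zigzag, whose structure uses h^+ for linv and h^- for rinv; the other
   unit and its structure are given by the generic invertibility structure. *)
split; eexists; rewrite -E; apply: wf_tm_rec Hs.
- exact: (wf_tm_des Linv Wn).
- exact: Wt.
- exact: Wt.
- exact: wf_linv_unit Wn.
- exact: (wf_tm_des Lunit Wn).
- rewrite einv_extE; apply: wf_linv_iunit; first exact: wf_ext_gen.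
  exact: wf_hyp_r.
- rewrite einv_extE; apply: (wf_tm_des Ilunit); exact: wf_ext_gen.
- exact: (wf_tm_des Rinv Wn).
- exact: Wt.
- exact: Wt.
- exact: (wf_tm_des Runit Wn).
- exact: wf_rinv_unit Wn.
- rewrite einv_extE; apply: (wf_tm_des Irunit); exact: wf_ext_gen.
- rewrite einv_extE; apply: wf_rinv_iunit; first exact: wf_ext_gen.
  exact: wf_hyp_l.
Qed.
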